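(* Let $\lambda>0$, let $\mathcal R_i=\mathcal R_i(\lambda)$, $i=1,2,3$, be the families of relative equilibria $\xi_\pm(r,\lambda)$ of the Kowalevski–Yehia gyrostat, and let $\delta_i$ be the corresponding regions of the $(r,\lambda)$-plane (all defined in the context). Consider the following curves, where $\pi_{ij}$ is contained in $\delta_i$: $$\pi_{21}:\ r=\lambda-\lambda^{-1/3},\quad 0<\lambda\le 1;$$ $$\pi_{22}:\ r=-\lambda,\quad \lambda>0;$$ $$\pi_{23}:\ r=\frac{\sigma^4-4}{2\sigma^3},\quad \lambda=\frac{3\sigma^4-4}{2\sigma^3},\quad \sigma\in(\sqrt[4]{4/3},\sqrt2\,];$$ $$\pi_{24}:\ r=\tfrac12\left(\lambda-\sqrt{\lambda^2+4\lambda^{2/3}}\right),\quad \lambda>0;$$ $$\pi_{31}:\ r=\frac{\sigma^4-4}{2\sigma^3},\quad \lambda=\frac{3\sigma^4-4}{2\sigma^3},\quad \sigma\in(-\sqrt[4]{4/3},0).$$ (1) A relative equilibrium $\xi_\pm(r,\lambda)\in\mathcal R_i(\lambda)$, $(r,\lambda)\in\delta_i$, is degenerate if and only if $(r,\lambda)$ lies on one of the curves $\pi_{ij}$ with first index $i$ (so there are no degenerate points in $\mathcal R_1$). Only the curve $\pi_{21}$ corresponds to strongly degenerate points. (2) The curves split the set of nondegenerate relative equilibria in the extended set $\Lambda(\mathcal R)$ into exactly $11$ classes. These are the preimages, under $\xi_\pm(r,\lambda)\mapsto(r,\lambda)$, of $\delta_1$ (in $\Lambda(\mathcal R_1)$),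 of the following eight subregions of $\delta_2=\{r\le 0,\ \lambda>0\}$ (in $\Lambda(\mathcal R_2)$): - $\delta_{21}$: $r>-\lambda$, $\lambda(\lambda-r)^3<1$; - $\delta_{22}$: $r<-\lambda$, $r(r-\lambda)<\lambda^{2/3}$; - $\delta_{23}$: $r(r-\lambda)>\lambda^{2/3}$, $(\lambda-r)^3(\lambda-3r)<4$; - $\delta_{24}$: $(\lambda-r)^3(\lambda-3r)>4$, $\lambda(\lambda-r)^3<1$; - $\delta_{25}$: $r<-\lambda$, $\lambda(\lambda-r)^3>1$; - $\delta_{26}$: $(\lambda-r)^3(\lambda-3r)<4$, $\lambda(\lambda-r)^3>1$; - $\delta_{27}$: $(\lambda-r)^3(\lambda-3r)>4$, $r(r-\lambda)<\lambda^{2/3}$; - $\delta_{28}$: $r>-\lambda$, $r(r-\lambda)>\lambda^{2/3}$; and of the following two subregions of $\delta_3=\{r>\lambda>0\}$ (in $\Lambda(\mathcal R_3)$): - $\delta_{31}$: $(r-\lambda)^3(3r-\lambda)<4$; - $\delta_{32}$: $(r-\lambda)^3(3r-\lambda)>4$. The classes over $\delta_1,\delta_{21},\delta_{26},\delta_{27}$ are connected; each of the others has exactly two connected components. (3) Let $\pm\mu_1,\pm\mu_2$ be the eigenvalues of $A_H$ (two zero eigenvalues discarded), where $$\mu_1^2=-\tfrac14\left[(2r-\lambda)(r-\lambda)-d\right],\qquad \mu_2^2=-\frac{1}{2(r-\lambda)}\left[(2r-\lambda)(r-\lambda)r+\lambda d\right].$$ Then the relative equilibria over the regions have the following characteristics: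 - over $\delta_1,\delta_{24},\delta_{25},\delta_{28},\delta_{32}$: $\mu_1^2<0$, $\mu_2^2<0$, type ''center-center'', stable in all variables; - over $\delta_{27}$: $\mu_1^2<0$, $\mu_2^2>0$, type ''center-saddle'', stable in two variables and unstable in two; - over $\delta_{23},\delta_{31}$: $\mu_1^2>0$, $\mu_2^2<0$, type ''saddle-center'', stable in two variables and unstable in two; - over $\delta_{21},\delta_{22},\delta_{26}$: $\mu_1^2>0$, $\mu_2^2>0$, type ''saddle-saddle'', unstable in all variables.
   Context: **System.** For $\lambda>0$ the Kowalevski–Yehia gyrostat is the system on $P^5=\mathbb R^3_\omega\times S^2_\alpha\subset\mathbb R^6$ ($\Gamma=|\alpha|^2=1$): $2\dot\omega_1=\omega_2(\omega_3-\lambda)$, $2\dot\omega_2=-\omega_1(\omega_3-\lambda)-\alpha_3$, $\dot\omega_3=\alpha_2$, $\dot\alpha_1=\alpha_2\omega_3-\alpha_3\omega_2$, $\dot\alpha_2=\alpha_3\omega_1-\alpha_1\omega_3$, $\dot\alpha_3=\alpha_1\omega_2-\alpha_2\omega_1$. Its first integrals are $H=\omega_1^2+\omega_2^2+\frac12\omega_3^2-\alpha_1$, $L=\omega_1\alpha_1+\omega_2\alpha_2+\frac12(\omega_3+\lambda)\alpha_3$, $K=(\omega_1^2-\omega_2^2+\alpha_1)^2+(2\omega_1\omega_2+\alpha_2)^2+2\lambda[(\omega_3-\lambda)(\omega_1^2+\omega_2^2)+2\omega_1\alpha_3]$. With $M=(2\omega_1,2\omega_2,\omega_3+\lambda)$,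 the Hamiltonian field $\mathrm{sgrad}\,F$ of a function $F$ on $\mathbb R^6$ is $\dot M=M\times\frac{\partial F}{\partial M}+\alpha\times\frac{\partial F}{\partial\alpha}$, $\dot\alpha=\alpha\times\frac{\partial F}{\partial M}$. The system above is $\mathrm{sgrad}\,H$. The functions $\Gamma,L$ are Casimirs, and the reduced systems live on the 4-dimensional symplectic manifolds $P^4_\ell=\{\Gamma=1,\,L=\ell\}$. **Relative equilibria.** A relative equilibrium is a fixed point of the system in $P^5$; it is considered as a fixed point of the reduced system on the $P^4_\ell$ containing it. All of them are given by $\xi_\pm(r,\lambda)$: $\omega_1=\pm V$, $\omega_2=0$, $\omega_3=r$, $\alpha_1=\frac12[r(r-\lambda)-d]$, $\alpha_2=0$, $\alpha_3=\mp(r-\lambda)V$, where $d^2=r^2(r-\lambda)^2+4$ and $V=\sqrt{\frac r2\left[-r+\frac{d}{r-\lambda}\right]}\ge 0$. The sign of $d$ equals the sign of $r(r-\lambda)$ for $r\neq0$ and is arbitrary for $r=0$. The set $\mathcal R(\lambda)$ of relative equilibria is the union of - $\mathcal R_1$: $0\le r<\lambda$, $d<0$ (at $r=0$: $d=-2$, the point $c_+$: $\omega=0$, $\alpha=(1,0,0)$); - $\mathcal R_2$: $r\le0$, $d>0$ (at $r=0$: $d=2$, the point $c_-$: $\omega=0$, $\alpha=(-1,0,0)$); - $\mathcal R_3$: $r>\lambda$, $d>0$. For $r=0$, $\xi_+=\xi_-$, equal to $c_+$ or $c_-$ according to the family considered. The corresponding parameter regions are $\delta_1=\{0\le r<\lambda\}$,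 $\delta_2=\{r\le0,\ \lambda>0\}$, $\delta_3=\{r>\lambda>0\}$. **Extended sets.** For a family $S(\lambda)\subset P^5$, $\lambda>0$, put $\Lambda(S)=\bigcup_{\lambda>0}S(\lambda)\times\{\lambda\}\subset P^5\times\mathbb R$. **Nondegeneracy.** At a fixed point $x_0$ of $\mathrm{sgrad}\,F$, $A_F$ denotes the linearization of $\mathrm{sgrad}\,F$ at $x_0$ on $T_{x_0}P^4_\ell$. Equivalently, one may linearize in $\mathbb R^6(\omega,\alpha)$ and discard from the spectrum the two zero eigenvalues that always exist because of the Casimirs $\Gamma, L$. Relative equilibria are fixed points of both $\mathrm{sgrad}\,H$ and $\mathrm{sgrad}\,K$. The point $x_0$ is nondegenerate if (1°) $A_H$ and $A_K$ are linearly independent and (2°) some linear combination of $A_H$ and $A_K$ has four distinct eigenvalues. Otherwise it is degenerate; a degenerate point is strongly degenerate if 1° fails and weakly degenerate otherwise. **Type and stability.** The type of a relative equilibrium with $\det A_H\ne0$ and real $\mu_1^2,\mu_2^2$ is read off from the two pairs $\pm\mu_1$, $\pm\mu_2$ of eigenvalues of $A_H$, in this order: a purely imaginary pair ($\mu_i^2<0$) gives ''center'', a real pair ($\mu_i^2>0$) gives ''saddle''. The stability terminology refers to the reduced system and is determined by the type: ''center-center'' means stable in all (four) variables, ''center-saddle'' and ''saddle-center'' mean stable in two variables and unstable in two, ''saddle-saddle'' means unstable in all variables. **Classes.** Let $\boldsymbol\tau:(\omega_1,\alpha_3)\mapsto(-\omega_1,-\alpha_3)$ (other coordinates and $\lambda$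 unchanged), a symmetry of $\Lambda(\mathcal R)$ interchanging $\xi_+$ and $\xi_-$. Two nondegenerate points $\xi_1,\xi_2\in\Lambda(\mathcal R)$ belong to the same class if there is a continuous path in $\Lambda(\mathcal R)$ joining $\xi_1$ to $\xi_2$ or to $\boldsymbol\tau(\xi_2)$ along which all points are nondegenerate and the type does not change. *)

(* Defs.v *)
From mathcomp Require Import all_boot all_order all_algebra.
From mathcomp Require Import complex.
From mathcomp Require Import all_classical all_reals all_analysis.

Set Implicit Arguments.
Unset Strict Implicit.
Unset Printing Implicit Defensive.

Import Order.TTheory GRing.Theory Num.Theory.
Import numFieldNormedType.Exports.

Local Open Scope classical_set_scope.
Local Open Scope ring_scope.

Section Gyrostat.
Variable R : realType.

(* A point (omega, alpha) of R^6 is [row_mx omega alpha]; the indices 0, 1, 2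
   of each half stand for the subscripts 1, 2, 3. *)
Definition phase := 'rV[R]_(3 + 3).

Definition vec3 (a b c : R) : 'rV[R]_3 := \row_(j < 3) [:: a; b; c]`_j.

Definition cross3 (u v : 'rV[R]_3) : 'rV[R]_3 :=
  vec3 (u 0 1 * v 0 2%:R - u 0 2%:R * v 0 1)
       (u 0 2%:R * v 0 0 - u 0 0 * v 0 2%:R)
       (u 0 0 * v 0 1 - u 0 1 * v 0 0).

Definition omega_of (x : phase) : 'rV[R]_3 := lsubmx x.
Definition alpha_of (x : phase) : 'rV[R]_3 := rsubmx x.

Definition om1 (x : phase) : R := omega_of x 0 0.
Definition om2 (x : phase) : R := omega_of x 0 1.
Definition om3 (x : phase) : R := omega_of x 0 2%:R.
Definition al1 (x : phase) : R := alpha_of x 0 0.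
Definition al2 (x : phase) : R := alpha_of x 0 1.
Definition al3 (x : phase) : R := alpha_of x 0 2%:R.

Definition mkphase (w1 w2 w3 a1 a2 a3 : R) : phase :=
  row_mx (vec3 w1 w2 w3) (vec3 a1 a2 a3).

Definition gyrostat (lam : R) (x : phase) : phase :=
  mkphase (om2 x * (om3 x - lam) / 2)
          ((- om1 x * (om3 x - lam) - al3 x) / 2)
          (al2 x)
          (al2 x * om3 x - al3 x * om2 x)
          (al3 x * om1 x - al1 x * om3 x)
          (al1 x * om2 x - al2 x * om1 x).

Definition Gam (x : phase) : R := al1 x ^+ 2 + al2 x ^+ 2 + al3 x ^+ 2.

Definition Ham (x : phase) : R :=
  om1 x ^+ 2 + om2 x ^+ 2 + om3 x ^+ 2 / 2 - al1 x.

Definition Lint (lam : R) (x : phase) : R :=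
  om1 x * al1 x + om2 x * al2 x + (om3 x + lam) * al3 x / 2.

Definition Kint (lam : R) (x : phase) : R :=
  (om1 x ^+ 2 - om2 x ^+ 2 + al1 x) ^+ 2 + (2 * om1 x * om2 x + al2 x) ^+ 2
  + 2 * lam * ((om3 x - lam) * (om1 x ^+ 2 + om2 x ^+ 2) + 2 * om1 x * al3 x).

Definition P5 : set phase := [set x | Gam x = 1].

Definition Mvec (lam : R) (x : phase) : 'rV[R]_3 :=
  vec3 (2 * om1 x) (2 * om2 x) (om3 x + lam).

Definition d_omega (F : phase -> R) (x : phase) (j : 'I_3) : R :=
  'D_(delta_mx 0 (lshift 3 j)) F x.
Definition d_alpha (F : phase -> R) (x : phase) (j : 'I_3) : R :=
  'D_(delta_mx 0 (rshift 3 j)) F x.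

(* dF/dM, by the chain rule for omega = (M_1 / 2, M_2 / 2, M_3 - lam). *)
Definition dF_dM (F : phase -> R) (x : phase) : 'rV[R]_3 :=
  vec3 (d_omega F x 0 / 2) (d_omega F x 1 / 2) (d_omega F x 2%:R).
Definition dF_dalpha (F : phase -> R) (x : phase) : 'rV[R]_3 :=
  \row_(j < 3) d_alpha F x j.

(* The Hamiltonian field, with its M-part converted back to the coordinates
   omega of the phase space. *)
Definition sgrad (lam : R) (F : phase -> R) (x : phase) : phase :=
  let Mdot := cross3 (Mvec lam x) (dF_dM F x)
              + cross3 (alpha_of x) (dF_dalpha F x) in
  row_mx (vec3 (Mdot 0 0 / 2) (Mdot 0 1 / 2) (Mdot 0 2%:R))
         (cross3 (alpha_of x) (dF_dM F x)).

Definition casimirs (lam : R) (x : phase) : 'rV[R]_2 :=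
  \row_(j < 2) [:: Gam x; Lint lam x]`_j.

(* The tangent space at [x] of the symplectic leaf through [x], as a row
   space: the kernel of the differential of (Gamma, L). *)
Definition Tleaf (lam : R) (x : phase) : 'M[R]_(3 + 3) :=
  kermx (jacobian (casimirs lam) x).

(* The linearization A_F of [sgrad F] at a fixed point, restricted to [Tleaf]
   and written in the basis [row_base (Tleaf lam x)]; as everywhere in the
   library, matrices act on row vectors from the right. *)
Definition linz (lam : R) (F : phase -> R) (x : phase) :
    'M[R]_(\rank (Tleaf lam x)) :=
  restrictmx (Tleaf lam x) (jacobian (sgrad lam F) x).

Definition A_H (lam : R) (x : phase) := linz lam Ham x.
Definition A_K (lam : R) (x : phase) := linz lam (Kint lam) x.

Definition complexify n (A : 'M[R]_n) : 'M[complex R]_n :=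
  map_mx (real_complex R) A.

(* The extended phase space: points (x, lam). *)
Definition ext := (phase * R)%type.

Definition cond_indep (p : ext) : Prop := free [:: A_H p.2 p.1; A_K p.2 p.1].

Definition cond_spectrum (p : ext) : Prop :=
  exists a b : R, exists s : seq (complex R),
    [/\ uniq s, size s = 4%N &
        all (eigenvalue (complexify (a *: A_H p.2 p.1 + b *: A_K p.2 p.1))) s].

Definition is_nondegenerate (p : ext) : Prop := cond_indep p /\ cond_spectrum p.
Definition is_degenerate (p : ext) : Prop := ~ is_nondegenerate p.
Definition is_strongly_degenerate (p : ext) : Prop :=
  is_degenerate p /\ ~ cond_indep p.

Definition rel_equilibria (lam : R) : set phase :=
  [set x | P5 x /\ gyrostat lam x = 0].

Definition Lambda (S : R -> set phase) : set ext :=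
  [set p | 0 < p.2 /\ S p.2 p.1].

Inductive equil_family := F1 | F2 | F3.

(* Regions and curves are sets of pairs (r, lam). *)
Definition delta_reg (i : equil_family) : set (R * R) :=
  match i with
  | F1 => [set q | 0 <= q.1 /\ q.1 < q.2]
  | F2 => [set q | q.1 <= 0 /\ 0 < q.2]
  | F3 => [set q | 0 < q.2 /\ q.2 < q.1]
  end.

Definition d_of (i : equil_family) (r lam : R) : R :=
  let s := Num.sqrt (r ^+ 2 * (r - lam) ^+ 2 + 4) in
  match i with F1 => - s | F2 => s | F3 => s end.

Definition V_of (i : equil_family) (r lam : R) : R :=
  Num.sqrt (r / 2 * (- r + d_of i r lam / (r - lam))).

(* [xi i false] is xi_+ and [xi i true] is xi_- in the i-th family. *)
Definition xi (i : equil_family) (s : bool) (r lam : R) : phase :=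
  let V := (-1) ^+ s * V_of i r lam in
  mkphase V 0 r
          ((r * (r - lam) - d_of i r lam) / 2) 0 (- (r - lam) * V).

Definition Rfam (i : equil_family) (lam : R) : set phase :=
  [set x | exists s r, delta_reg i (r, lam) /\ x = xi i s r lam].

Definition xi_ext (i : equil_family) (s : bool) (r lam : R) : ext :=
  (xi i s r lam, lam).

Definition mu1sq (i : equil_family) (r lam : R) : R :=
  - (((2 * r - lam) * (r - lam) - d_of i r lam) / 4).

Definition mu2sq (i : equil_family) (r lam : R) : R :=
  - (((2 * r - lam) * (r - lam) * r + lam * d_of i r lam)
     / (2 * (r - lam))).

(* [m1], [-m1], [m2], [-m2] are the eigenvalues of A_H with multiplicity. *)
Definition eigenvalue_pairs (p : ext) (m1 m2 : complex R) : Prop :=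
  char_poly (complexify (A_H p.2 p.1)) =
  \prod_(z <- [:: m1; - m1; m2; - m2]) ('X - z%:P).

Inductive pair_type := Center | Saddle.

Definition has_sign (k : pair_type) (x : R) : Prop :=
  match k with Center => x < 0 | Saddle => 0 < x end.

(* In [complex R], [z < 0] and [0 < z] entail that z is real. *)
Definition pair_kind (k : pair_type) (m : complex R) : Prop :=
  match k with Center => m ^+ 2 < 0 | Saddle => 0 < m ^+ 2 end.

(* The formulas for mu_1^2 and mu_2^2 fix the order of the two pairs. *)
Definition has_type (p : ext) (t : pair_type * pair_type) : Prop :=
  exists i s r lam, [/\ delta_reg i (r, lam), p = xi_ext i s r lam,
    \det (A_H p.2 p.1) != 0 &
    exists m1 m2 : complex R,
      [/\ eigenvalue_pairs p m1 m2,
          m1 ^+ 2 = real_complex R (mu1sq i r lam),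
          m2 ^+ 2 = real_complex R (mu2sq i r lam),
          pair_kind t.1 m1 & pair_kind t.2 m2]].

Inductive stability :=
  StableInAll | StableInTwoUnstableInTwo | UnstableInAll.

Definition stability_of_type (t : pair_type * pair_type) : stability :=
  match t with
  | (Center, Center) => StableInAll
  | (Center, Saddle) | (Saddle, Center) => StableInTwoUnstableInTwo
  | (Saddle, Saddle) => UnstableInAll
  end.

Definition has_stability (p : ext) (st : stability) : Prop :=
  exists t, has_type p t /\ stability_of_type t = st.

Definition tau (p : ext) : ext :=
  (mkphase (- om1 p.1) (om2 p.1) (om3 p.1) (al1 p.1) (al2 p.1) (- al3 p.1),
   p.2).

Definition nondeg_equilibria : set ext :=
  Lambda rel_equilibria `&` is_nondegenerate.

Definition joined (p q : ext) : Prop :=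
  exists g : R -> ext,
    [/\ {within `[0, 1], continuous g}, g 0 = p, g 1 = q &
        exists t, forall u, u \in `[0, 1] ->
          nondeg_equilibria (g u) /\ has_type (g u) t].

Definition same_class (p q : ext) : Prop :=
  [/\ nondeg_equilibria p, nondeg_equilibria q &
      joined p q \/ joined p (tau q)].

Definition equilibrium_classes : set (set ext) :=
  [set [set q | same_class p q] | p in nondeg_equilibria].

Definition conn_components (A : set ext) : set (set ext) :=
  [set connected_component A x | x in A].

Inductive curve := Pi21 | Pi22 | Pi23 | Pi24 | Pi31.

Definition curve_family (c : curve) : equil_family :=
  match c with Pi31 => F3 | _ => F2 end.

Definition curve_set (c : curve) : set (R * R) :=
  match c with
  | Pi21 => [set q | q.1 = q.2 - q.2 `^ (- 3^-1) /\ 0 < q.2 <= 1]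
  | Pi22 => [set q | q.1 = - q.2 /\ 0 < q.2]
  | Pi23 => [set q | exists sg : R,
      [/\ (4 / 3) `^ (4^-1) < sg <= Num.sqrt 2,
          q.1 = (sg ^+ 4 - 4) / (2 * sg ^+ 3) &
          q.2 = (3 * sg ^+ 4 - 4) / (2 * sg ^+ 3)]]
  | Pi24 => [set q |
      q.1 = (q.2 - Num.sqrt (q.2 ^+ 2 + 4 * q.2 `^ (2 / 3))) / 2 /\ 0 < q.2]
  | Pi31 => [set q | exists sg : R,
      [/\ - ((4 / 3) `^ (4^-1)) < sg < 0,
          q.1 = (sg ^+ 4 - 4) / (2 * sg ^+ 3) &
          q.2 = (3 * sg ^+ 4 - 4) / (2 * sg ^+ 3)]]
  end.

Inductive region :=
  D1 | D21 | D22 | D23 | D24 | D25 | D26 | D27 | D28 | D31 | D32.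

Definition region_family (k : region) : equil_family :=
  match k with D1 => F1 | D31 | D32 => F3 | _ => F2 end.

Definition region_ineq (k : region) (r lam : R) : Prop :=
  match k with
  | D1 => True
  | D21 => r > - lam /\ lam * (lam - r) ^+ 3 < 1
  | D22 => r < - lam /\ r * (r - lam) < lam `^ (2 / 3)
  | D23 => r * (r - lam) > lam `^ (2 / 3) /\
           (lam - r) ^+ 3 * (lam - 3 * r) < 4
  | D24 => (lam - r) ^+ 3 * (lam - 3 * r) > 4 /\ lam * (lam - r) ^+ 3 < 1
  | D25 => r < - lam /\ lam * (lam - r) ^+ 3 > 1
  | D26 => (lam - r) ^+ 3 * (lam - 3 * r) < 4 /\ lam * (lam - r) ^+ 3 > 1
  | D27 => (lam - r) ^+ 3 * (lam - 3 * r) > 4 /\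
           r * (r - lam) < lam `^ (2 / 3)
  | D28 => r > - lam /\ r * (r - lam) > lam `^ (2 / 3)
  | D31 => (r - lam) ^+ 3 * (3 * r - lam) < 4
  | D32 => (r - lam) ^+ 3 * (3 * r - lam) > 4
  end.

Definition region_set (k : region) : set (R * R) :=
  [set q | delta_reg (region_family k) q /\ region_ineq k q.1 q.2].

Definition over_region (k : region) : set ext :=
  [set p | exists s r lam, region_set k (r, lam) /\
                           p = xi_ext (region_family k) s r lam].

Definition region_connected (k : region) : bool :=
  match k with D1 | D21 | D26 | D27 => true | _ => false end.

Definition region_type (k : region) : pair_type * pair_type :=
  match k with
  | D1 | D24 | D25 | D28 | D32 => (Center, Center)
  | D27 => (Center, Saddle)
  | D23 | D31 => (Saddle, Center)
  | D21 | D22 | D26 => (Saddle, Saddle)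
  end.

Definition region_stability (k : region) : stability :=
  match k with
  | D1 | D24 | D25 | D28 | D32 => StableInAll
  | D27 | D23 | D31 => StableInTwoUnstableInTwo
  | D21 | D22 | D26 => UnstableInAll
  end.

End Gyrostat.

(* Main.v *)
(* At a relative equilibrium the reversing symmetry
   (omega_2, alpha_2) |-> -(omega_2, alpha_2) splits the tangent space of the
   leaf into two planes exchanged by A_H and A_K.  In a basis formed by the odd
   plane and its image under A_H the two operators are [0, I; S, 0] and
   [0, N; S N, 0] with S, N commuting triangular 2x2 matrices, so that
   a A_H + b A_K has the squared eigenvalues (a + b n_i)^2 mu_i^2.  A point is
   therefore nondegenerate iff mu_1, mu_2 <> 0 and n_1 <> n_2, and strongly
   degenerate iff N is scalar.  As alpha_1 is a root of
   a^2 - r (r - lam) a - 1, of known sign, the signs of mu_1^2, mu_2^2 and of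
   the factors of n_1 - n_2 become polynomial conditions on (r, lam), namely
   the curves.  The signs of these polynomials are constant along paths of
   nondegenerate points, which separates the regions; in the coordinates
   lam / (lam - r), (lam - r)^-4 each region lies between two graphs, which
   makes it path connected.  The sign of omega_1 separates the two sheets
   xi_+, xi_-, which meet only at r = 0. *)
Require Import Defs.
From mathcomp Require Import all_boot all_order all_algebra.
From mathcomp Require Import complex ring lra.
From mathcomp Require Import all_classical all_reals all_analysis.
Import Order.TTheory GRing.Theory Num.Theory.
Import numFieldNormedType.Exports.
Local Open Scope classical_set_scope.
Local Open Scope ring_scope.

Set Implicit Arguments.
Unset Strict Implicit.
Unset Printing Implicit Defensive.

(** * Polynomial vector fields *)

(** [A_H] and [A_K] have size [\rank (Tleaf lam x)], which equals 4 only by proof, and they refer to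
    an unspecified row basis. They are therefore never computed entrywise, but conjugated to
    explicit 4x4 matrices by mutually inverse matrices of rectangular type. To keep square roots out
    of these matrices, an equilibrium is written with omega_1 = w, omega_3 = r, rho = r - lam and z
    = alpha_1 / rho, tied by r z = - w^2. The radical d enters only afterwards, through the
    quadratic equation of alpha_1. The two factors of n_1 - n_2 = 2 (r + lam) (z - lam) act
    differently. If z = lam, N is scalar and A_K is a multiple of A_H. If r = - lam and z <> lam, N
    is a nontrivial Jordan block; commuting with it forces mu_1^2 = mu_2^2, so the two pairs of
    eigenvalues coincide in every linear combination although A_H and A_K are independent. This is
    why condition 2 really fails there. *)

Section PolynomialFields.
Variable R : realType.
Notation phase := (phase R).

Lemma om1_mkphase (w1 w2 w3 a1 a2 a3 : R) : om1 (mkphase w1 w2 w3 a1 a2 a3) = w1.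
Proof. by rewrite /om1 /omega_of row_mxKl mxE. Qed.
Lemma om2_mkphase (w1 w2 w3 a1 a2 a3 : R) : om2 (mkphase w1 w2 w3 a1 a2 a3) = w2.
Proof. by rewrite /om2 /omega_of row_mxKl mxE. Qed.
Lemma om3_mkphase (w1 w2 w3 a1 a2 a3 : R) : om3 (mkphase w1 w2 w3 a1 a2 a3) = w3.
Proof. by rewrite /om3 /omega_of row_mxKl mxE. Qed.
Lemma al1_mkphase (w1 w2 w3 a1 a2 a3 : R) : al1 (mkphase w1 w2 w3 a1 a2 a3) = a1.
Proof. by rewrite /al1 /alpha_of row_mxKr mxE. Qed.
Lemma al2_mkphase (w1 w2 w3 a1 a2 a3 : R) : al2 (mkphase w1 w2 w3 a1 a2 a3) = a2.
Proof. by rewrite /al2 /alpha_of row_mxKr mxE. Qed.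
Lemma al3_mkphase (w1 w2 w3 a1 a2 a3 : R) : al3 (mkphase w1 w2 w3 a1 a2 a3) = a3.
Proof. by rewrite /al3 /alpha_of row_mxKr mxE. Qed.

Definition mkphaseE :=
  (om1_mkphase, om2_mkphase, om3_mkphase, al1_mkphase, al2_mkphase, al3_mkphase).

Lemma vec3_eta (v : 'rV[R]_3) : v = vec3 (v 0 0) (v 0 1) (v 0 2%:R).
Proof.
apply/rowP => j; rewrite mxE.
by case: j => -[|[|[|//]]] h /=; congr (v 0 _); apply/val_inj.
Qed.

Lemma mkphase_eta (x : phase) :
  x = mkphase (om1 x) (om2 x) (om3 x) (al1 x) (al2 x) (al3 x).
Proof. by rewrite /mkphase -!vec3_eta hsubmxK. Qed.

Lemma vec3D (a b c a' b' c' : R) :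
  vec3 a b c + vec3 a' b' c' = vec3 (a + a') (b + b') (c + c').
Proof. by apply/rowP => j; rewrite !mxE; case: j => -[|[|[|//]]]. Qed.

Lemma vec3Z (k a b c : R) : k *: vec3 a b c = vec3 (k * a) (k * b) (k * c).
Proof. by apply/rowP => j; rewrite !mxE; case: j => -[|[|[|//]]]. Qed.

Lemma mkphaseD (a b c d e f a' b' c' d' e' f' : R) :
  mkphase a b c d e f + mkphase a' b' c' d' e' f' =
  mkphase (a + a') (b + b') (c + c') (d + d') (e + e') (f + f').
Proof. by rewrite /mkphase add_row_mx !vec3D. Qed.

Lemma mkphaseZ (k a b c d e f : R) :
  k *: mkphase a b c d e f =
  mkphase (k * a) (k * b) (k * c) (k * d) (k * e) (k * f).
Proof. by rewrite /mkphase scale_row_mx !vec3Z. Qed.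

Lemma mkphase0 : mkphase 0 0 0 0 0 0 = 0 :> phase.
Proof. by rewrite -[RHS](scale0r (mkphase 0 0 0 0 0 0)) mkphaseZ mul0r. Qed.

Lemma mkphase_inj (a b c d e f a' b' c' d' e' f' : R) :
  mkphase a b c d e f = mkphase a' b' c' d' e' f' ->
  [/\ a = a', b = b' & c = c'] /\ [/\ d = d', e = e' & f = f'].
Proof.
move=> h; split; split.
- by have := congr1 (@om1 R) h; rewrite !mkphaseE.
- by have := congr1 (@om2 R) h; rewrite !mkphaseE.
- by have := congr1 (@om3 R) h; rewrite !mkphaseE.
- by have := congr1 (@al1 R) h; rewrite !mkphaseE.
- by have := congr1 (@al2 R) h; rewrite !mkphaseE.
- by have := congr1 (@al3 R) h; rewrite !mkphaseE.
Qed.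

(* Polynomial expressions in the six coordinates, reified so that their
   directional derivatives are obtained by computation. *)
Inductive pexp :=
| Coord of 'I_6
| Const of R
| Add of pexp & pexp
| Mul of pexp & pexp.

Definition coord6 (i : 'I_6) (x : phase) : R :=
  [:: om1 x; om2 x; om3 x; al1 x; al2 x; al3 x]`_i.

Fixpoint peval (e : pexp) (x : phase) : R :=
  match e with
  | Coord i => coord6 i x
  | Const c => c
  | Add e1 e2 => peval e1 x + peval e2 x
  | Mul e1 e2 => peval e1 x * peval e2 x
  end.

Fixpoint pderiv (e : pexp) (v x : phase) : R :=
  match e with
  | Coord i => coord6 i v
  | Const c => 0
  | Add e1 e2 => pderiv e1 v x + pderiv e2 v x
  | Mul e1 e2 => peval e1 x * pderiv e2 v x + peval e2 x * pderiv e1 v x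
  end.

Lemma coord6E (i : 'I_6) : coord6 i = (fun x : phase => x 0 i).
Proof.
apply/funext => x; rewrite /coord6 /om1 /om2 /om3 /al1 /al2 /al3 /omega_of /alpha_of.
rewrite !mxE.
by case: i => -[|[|[|[|[|[|//]]]]]] h /=; congr (x 0 _); apply/val_inj.
Qed.

Lemma differentiable_coord6 (i : 'I_6) (x : phase) : differentiable (coord6 i) x.
Proof. by rewrite coord6E; exact: (@differentiable_coord R 1 6 x 0 i). Qed.

Lemma derive_coord6 (i : 'I_6) (v x : phase) : 'D_v (coord6 i) x = coord6 i v.
Proof.
rewrite coord6E /derive.
apply: cvg_lim => //.
(* A coordinate is linear, so its difference quotient is constant away from t = 0. *)
apply: cvg_near_cst; near=> t.
rewrite /= !mxE addrK -mulr_algl scaler1 mulrA mulVf ?mul1r //.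
by near: t; exact: nbhs_dnbhs_neq.
Unshelve. all: by end_near. Qed.

Lemma differentiable_peval (e : pexp) (x : phase) : differentiable (peval e) x.
Proof.
elim: e => [i|c|e1 h1 e2 h2|e1 h1 e2 h2] /=.
- exact: differentiable_coord6.
- exact: differentiable_cst.
- exact: differentiableD.
- exact: differentiableM.
Qed.

Lemma derive_peval (e : pexp) (v x : phase) : 'D_v (peval e) x = pderiv e v x.
Proof.
have dv e' : derivable (peval e') x v.
  by apply: diff_derivable; exact: differentiable_peval.
elim: e => [i|c|e1 h1 e2 h2|e1 h1 e2 h2] /=.
- exact: derive_coord6.
- exact: derive_cst.
- by rewrite deriveD // h1 h2.
- by rewrite deriveM // h1 h2.
Qed.

Lemma differentiable_row n (f : phase -> 'rV[R]_n) (x : phase) :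
  (forall j, differentiable (fun y => f y 0 j) x) -> differentiable f x.
Proof.
move=> h.
have -> : f = \sum_j (fun y => f y 0 j *: delta_mx 0 j).
  by apply/funext => y; rewrite fct_sumE [LHS]row_sum_delta.
by apply: differentiable_sum => j; apply: differentiableZl.
Qed.

Lemma derive_row n (f : phase -> 'rV[R]_n) (v x : phase) :
  (forall j, differentiable (fun y => f y 0 j) x) ->
  'D_v f x = \row_j 'D_v (fun y => f y 0 j) x.
Proof.
move=> h; rewrite derive_mx; first by apply/rowP => j; rewrite !mxE.
by apply/derivable_mxP => i j; rewrite ord1; apply: diff_derivable.
Qed.

Definition pfield (e1 e2 e3 e4 e5 e6 : pexp) (x : phase) : phase :=
  mkphase (peval e1 x) (peval e2 x) (peval e3 x) (peval e4 x) (peval e5 x) (peval e6 x).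

(** The Jacobian is never written as a matrix: only its action on a row vector occurs, and that is a
    directional derivative, which [pderiv] computes. *)
Lemma mul_jacobian_pfield e1 e2 e3 e4 e5 e6 (v x : phase) :
  v *m jacobian (pfield e1 e2 e3 e4 e5 e6) x =
  mkphase (pderiv e1 v x) (pderiv e2 v x) (pderiv e3 v x)
          (pderiv e4 v x) (pderiv e5 v x) (pderiv e6 v x).
Proof.
have E (j : 'I_6) : (fun y => pfield e1 e2 e3 e4 e5 e6 y 0 j) =
    peval (nth e1 [:: e1; e2; e3; e4; e5; e6] j).
  apply/funext => y; rewrite -[LHS]/((fun z : phase => z 0 j) _) -coord6E.
  by rewrite /coord6 !mkphaseE; case: j => -[|[|[|[|[|[|//]]]]]].
have D (j : 'I_6) : differentiable (fun y => pfield e1 e2 e3 e4 e5 e6 y 0 j) x.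
  by rewrite E; exact: differentiable_peval.
rewrite -deriveEjacobian; last exact: differentiable_row.
rewrite derive_row //; apply/rowP => j; rewrite mxE E derive_peval.
rewrite -[RHS]/((fun z : phase => z 0 j) _) -coord6E /coord6 !mkphaseE.
by case: j => -[|[|[|[|[|[|//]]]]]].
Qed.

End PolynomialFields.

(** * The Hamiltonian fields of H and K and the differential of the Casimirs *)

Section Gradients.
Variable R : realType.
Notation phase := (phase R).
Implicit Types (lam : R) (x : phase).

Definition grad_om (e : pexp R) (x : phase) : R * R * R :=
  (pderiv e (mkphase 1 0 0 0 0 0) x, pderiv e (mkphase 0 1 0 0 0 0) x,
   pderiv e (mkphase 0 0 1 0 0 0) x).
Definition grad_al (e : pexp R) (x : phase) : R * R * R :=
  (pderiv e (mkphase 0 0 0 1 0 0) x, pderiv e (mkphase 0 0 0 0 1 0) x,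
   pderiv e (mkphase 0 0 0 0 0 1) x).

Lemma cross3_vec3 (a b c a' b' c' : R) : cross3 (vec3 a b c) (vec3 a' b' c') =
  vec3 (b * c' - c * b') (c * a' - a * c') (a * b' - b * a').
Proof. by rewrite /cross3 !mxE. Qed.

Lemma delta_om (j : 'I_3) : delta_mx 0 (lshift 3 j) =
  mkphase (j == 0)%:R (j == 1)%:R (j == 2%:R)%:R 0 0 0 :> phase.
Proof.
rewrite /mkphase -[LHS]hsubmxK; congr row_mx; apply/rowP => k; rewrite !mxE.
  by rewrite eqxx (inj_eq (@lshift_inj _ _)) /=;
     case: j => -[|[|[|//]]] ?; case: k => -[|[|[|//]]].
by rewrite eq_rlshift; case: k => -[|[|[|//]]].
Qed.

Lemma delta_al (j : 'I_3) : delta_mx 0 (rshift 3 j) =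
  mkphase 0 0 0 (j == 0)%:R (j == 1)%:R (j == 2%:R)%:R :> phase.
Proof.
rewrite /mkphase -[LHS]hsubmxK; congr row_mx; apply/rowP => k; rewrite !mxE.
  by rewrite eq_lrshift; case: k => -[|[|[|//]]].
by rewrite eqxx (inj_eq (@rshift_inj _ _)) /=;
   case: j => -[|[|[|//]]] ?; case: k => -[|[|[|//]]].
Qed.

Lemma sgrad_peval lam e x : sgrad lam (peval e) x =
  let: (g1, g2, g3) := grad_om e x in
  let: (h1, h2, h3) := grad_al e x in
  mkphase
    ((2 * om2 x * g3 - (om3 x + lam) * (g2 / 2) + (al2 x * h3 - al3 x * h2)) / 2)
    (((om3 x + lam) * (g1 / 2) - 2 * om1 x * g3 + (al3 x * h1 - al1 x * h3)) / 2)
    (2 * om1 x * (g2 / 2) - 2 * om2 x * (g1 / 2) + (al1 x * h2 - al2 x * h1))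
    (al2 x * g3 - al3 x * (g2 / 2))
    (al3 x * (g1 / 2) - al1 x * g3)
    (al1 x * (g2 / 2) - al2 x * (g1 / 2)).
Proof.
rewrite /sgrad /dF_dM /Mvec (vec3_eta (alpha_of x)) (vec3_eta (dF_dalpha _ _)).
rewrite -/(al1 x) -/(al2 x) -/(al3 x) !cross3_vec3 vec3D !mxE /=.
by rewrite /d_omega /d_alpha !derive_peval !delta_om !delta_al.
Qed.

Declare Scope pexp_scope.
Delimit Scope pexp_scope with P.
Local Notation "a + b" := (Add a b) : pexp_scope.
Local Notation "a - b" := (Add a (Mul (Const (-1)) b)) : pexp_scope.
Local Notation "a * b" := (Mul a b) : pexp_scope.
Local Notation "# c" := (Const c) (at level 8, c at level 8) : pexp_scope.
Local Notation w1 := (Coord R (@Ordinal 6 0 isT)).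
Local Notation w2 := (Coord R (@Ordinal 6 1 isT)).
Local Notation w3 := (Coord R (@Ordinal 6 2 isT)).
Local Notation a1 := (Coord R (@Ordinal 6 3 isT)).
Local Notation a2 := (Coord R (@Ordinal 6 4 isT)).
Local Notation a3 := (Coord R (@Ordinal 6 5 isT)).

Definition Ham_pexp : pexp R :=
  (w1 * w1 + w2 * w2 + #(2^-1) * (w3 * w3) - a1)%P.

Definition Kint_pexp lam : pexp R :=
  let P := (w1 * w1 - w2 * w2 + a1)%P in
  let Q := (#2 * (w1 * w2) + a2)%P in
  (P * P + Q * Q
   + #(2 * lam)%R * ((w3 - # lam) * (w1 * w1 + w2 * w2) + #2 * (w1 * a3)))%P.

Lemma Ham_pexpE : @Ham R = peval Ham_pexp.
Proof. by apply/funext => x; rewrite /Ham /= /coord6 /=; field. Qed.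

Lemma Kint_pexpE lam : Kint lam = peval (Kint_pexp lam).
Proof. by apply/funext => x; rewrite /Kint /= /coord6 /=; ring. Qed.

(** The equations of motion again, in reified form so that the field can itself be differentiated by
    [mul_jacobian_pfield]. *)
Lemma sgrad_Ham lam : sgrad lam (@Ham R) =
  pfield (#(2^-1) * (w2 * (w3 - # lam)))%P
         (#(- 2^-1) * (w1 * (w3 - # lam) + a3))%P
         a2
         (a2 * w3 - a3 * w2)%P
         (a3 * w1 - a1 * w3)%P
         (a1 * w2 - a2 * w1)%P.
Proof.
apply/funext => x; rewrite Ham_pexpE sgrad_peval /grad_om /grad_al /pfield /=.
by rewrite /coord6 /= !mkphaseE; congr mkphase; field.
Qed.

(** [g1], [g2], [g3] are the components of dK/dM; those of dK/dalpha are [2 P], [2 Q] and [h3]. *)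
Lemma sgrad_Kint lam : sgrad lam (Kint lam) =
  let P := (w1 * w1 - w2 * w2 + a1)%P in
  let Q := (#2 * (w1 * w2) + a2)%P in
  let g1 := (#2 * (w1 * P + w2 * Q) + #(2 * lam)%R * (w1 * (w3 - # lam) + a3))%P in
  let g2 := (#2 * (w1 * Q - w2 * P) + #(2 * lam)%R * (w2 * (w3 - # lam)))%P in
  let g3 := (#(2 * lam)%R * (w1 * w1 + w2 * w2))%P in
  let h3 := (#(4 * lam)%R * w1)%P in
  pfield
    (#(2^-1) * (#2 * (w2 * g3) - (w3 + # lam) * g2 + a2 * h3 - #2 * (a3 * Q)))%P
    (#(2^-1) * ((w3 + # lam) * g1 - #2 * (w1 * g3) + #2 * (a3 * P) - a1 * h3))%P
    (#2 * (w1 * g2 - w2 * g1 + a1 * Q - a2 * P))%P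
    (a2 * g3 - a3 * g2)%P
    (a3 * g1 - a1 * g3)%P
    (a1 * g2 - a2 * g1)%P.
Proof.
apply/funext => x; rewrite Kint_pexpE sgrad_peval /grad_om /grad_al /pfield /=.
by rewrite /coord6 /= !mkphaseE; congr mkphase; field.
Qed.

Lemma casimirs_row lam (v x : phase) : v *m jacobian (casimirs lam) x =
  \row_(j < 2) [:: 2 * (al1 x * al1 v + al2 x * al2 v + al3 x * al3 v);
    om1 x * al1 v + al1 x * om1 v + (om2 x * al2 v + al2 x * om2 v)
    + ((om3 x + lam) * al3 v + al3 x * om3 v) / 2]`_j.
Proof.
have E (j : 'I_2) : (fun y => casimirs lam y 0 j) = peval
    (nth a1 [:: (a1 * a1 + a2 * a2 + a3 * a3)%P;
               (w1 * a1 + w2 * a2 + #(2^-1) * ((w3 + # lam) * a3))%P] j).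
  apply/funext => y; rewrite mxE /Gam /Lint.
  by case: j => -[|[|//]] h /=; rewrite /coord6 /=; field.
have D (j : 'I_2) : differentiable (fun y => casimirs lam y 0 j) x.
  by rewrite E; exact: differentiable_peval.
rewrite -deriveEjacobian; last exact: differentiable_row.
rewrite derive_row //; apply/rowP => j; rewrite !mxE E derive_peval.
by case: j => -[|[|//]] h /=; rewrite /coord6 /=; field.
Qed.

End Gradients.

(** * Bases of invariant subspaces and biquadratic spectra *)

Section MatrixTools.

Lemma free2P (K : fieldType) (vT : vectType K) (u v : vT) :
  free [:: u; v] <-> (forall a b : K, a *: u + b *: v = 0 -> a = 0 /\ b = 0).
Proof.
split=> [/(@freeP _ _ 2 [tuple u; v]) h a b e|h].
  have := h (fun i => [:: a; b]`_i); rewrite !big_ord_recl big_ord0 /= addr0 => /(_ e).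
  by move=> k; split; [exact: (k ord0) | exact: (k (lift ord0 ord0))].
apply/(@freeP _ _ 2 [tuple u; v]) => k.
rewrite !big_ord_recl big_ord0 /= addr0 => /h [k0 k1].
by case=> -[|[|//]] p; [rewrite -k0|rewrite -k1]; congr (k _); apply/val_inj.
Qed.

(** [restrictmx] works in the basis [row_base T], about which nothing is known. Any other basis [W]
    of the same space is related to it by the change of basis [P], [Q], stated with rectangular
    types because [\rank T] and [k] are not convertible. [P] and [Q] do not depend on [f], so the
    same pair serves both linearizations. *)
Lemma restrictmx_basis (F : fieldType) n k (T : 'M[F]_n) (W : 'M[F]_(k, n)) :
  row_free W -> (W :=: T)%MS ->
  exists (P : 'M[F]_(\rank T, k)) (Q : 'M[F]_(k, \rank T)),
    [/\ P *m Q = 1%:M, Q *m P = 1%:M &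
        forall f A, W *m f = A *m W -> restrictmx T f = P *m A *m Q].
Proof.
move=> fW eWT; set B := row_base T.
have fB : row_free B := row_base_free T.
have BW : (B <= W)%MS by rewrite eq_row_base eWT.
have WB : (W <= B)%MS by rewrite eq_row_base eWT.
exists (B *m pinvmx W), (W *m pinvmx B); split.
- by rewrite mulmxA mulmxKpV // mulmxVp.
- by rewrite mulmxA mulmxKpV // mulmxVp.
- move=> f A e; rewrite /conjmx -/B -{1}(mulmxKpV BW) -(mulmxA _ W) e.
  by rewrite !mulmxA.
Qed.

Section Conjugation.
Variables (F : fieldType) (m k : nat) (P : 'M[F]_(m, k)) (Q : 'M[F]_(k, m)).
Hypotheses (PQ : P *m Q = 1%:M) (QP : Q *m P = 1%:M).

Lemma conj_dim : m = k.
Proof. by apply/eqP; rewrite eqn_leq (mulmx1_min PQ) (mulmx1_min QP). Qed.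

Lemma conj_det (A : 'M[F]_k) : \det (P *m A *m Q) = \det A.
Proof.
move: P Q PQ QP; rewrite conj_dim => P' Q' PQ' QP'.
by rewrite !det_mulmx mulrAC -det_mulmx PQ' det1 mul1r.
Qed.

Lemma conj_eq0 (A : 'M[F]_k) : P *m A *m Q = 0 -> A = 0.
Proof.
move=> /(congr1 (fun X => Q *m X *m P)).
by rewrite !mulmxA QP mul1mx -mulmxA QP mulmx1 mulmx0 mul0mx.
Qed.
End Conjugation.

Lemma conj_char_poly (F : fieldType) m k (P : 'M[F]_(m, k)) (Q : 'M[F]_(k, m))
    (A : 'M[F]_k) : P *m Q = 1%:M -> Q *m P = 1%:M ->
  char_poly (P *m A *m Q) = char_poly A.
Proof.
move=> PQ QP; have e := conj_dim PQ QP; subst m.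
rewrite /char_poly /char_poly_mx.
have -> : 'X%:M - map_mx polyC (P *m A *m Q) =
    map_mx polyC P *m ('X%:M - map_mx polyC A) *m map_mx polyC Q.
  rewrite mulmxBr mulmxBl -!map_mxM /=; congr (_ - _).
  by rewrite mul_mx_scalar -scalemxAl -map_mxM PQ map_mx1 scalemx1.
by rewrite !det_mulmx mulrAC -det_mulmx -map_mxM PQ map_mx1 det1 mul1r.
Qed.

Definition antimx (F : pzRingType) (p11 p12 p22 q11 q12 q22 : F) : 'M[F]_4 :=
  \matrix_(i, j) (nth [::] [:: [:: 0; 0; p11; p12]; [:: 0; 0; 0; p22];
                              [:: q11; q12; 0; 0]; [:: 0; q22; 0; 0]] i)`_j.

(** For a block matrix [0, P; Q, 0] the characteristic polynomial is det (X^2 - P Q), and P Q is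
    triangular with diagonal p11 q11, p22 q22. *)
Lemma char_poly_antimx (F : comNzRingType) (p11 p12 p22 q11 q12 q22 : F) :
  char_poly (antimx p11 p12 p22 q11 q12 q22) =
  ('X^2 - (p11 * q11)%:P) * ('X^2 - (p22 * q22)%:P).
Proof.
have simp0 := (mulr0n, mulr1n, polyC0, subr0, sub0r, mul0r, mulr0, add0r, addr0).
rewrite /char_poly (expand_det_row _ ord0) !big_ord_recl big_ord0 !mxE /= ?simp0.
rewrite /cofactor !(expand_det_row _ ord0) !big_ord_recl !big_ord0 !mxE /= ?simp0.
rewrite /cofactor !(expand_det_row _ ord0) !big_ord_recl !big_ord0 !mxE /= ?simp0.
rewrite /cofactor !det_mx11 !mxE /= ?simp0.
rewrite !rmorphM /= /bump /= !(add0n, addn0, add1n, addSn, expr0, expr1, exprS).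
ring.
Qed.

Lemma antimx_comb (F : comNzRingType) (a b p11 p12 p22 q11 q12 q22
    p11' p12' p22' q11' q12' q22' : F) :
  a *: antimx p11 p12 p22 q11 q12 q22 + b *: antimx p11' p12' p22' q11' q12' q22' =
  antimx (a * p11 + b * p11') (a * p12 + b * p12') (a * p22 + b * p22')
         (a * q11 + b * q11') (a * q12 + b * q12') (a * q22 + b * q22').
Proof.
apply/matrixP => i j; rewrite !mxE.
by case: i => -[|[|[|[|//]]]] ?; case: j => -[|[|[|[|//]]]] ? //=;
  rewrite !mulr0 addr0.
Qed.

Lemma antimx_eq0 (F : pzRingType) (p11 p12 p22 q11 q12 q22 : F) :
  antimx p11 p12 p22 q11 q12 q22 = 0 -> [/\ p11 = 0, p12 = 0 & p22 = 0].
Proof.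
move=> /matrixP h; split.
- by have := h ord0 (inord 2); rewrite !mxE inordK.
- by have := h ord0 (inord 3); rewrite !mxE inordK.
- by have := h (inord 1) (inord 3); rewrite !mxE !inordK.
Qed.

Lemma char_poly_pairs (F : comNzRingType) (u v : F) :
  ('X^2 - (u ^+ 2)%:P) * ('X^2 - (v ^+ 2)%:P) =
  \prod_(z <- [:: u; - u; v; - v]) ('X - z%:P).
Proof.
rewrite !big_cons big_nil !rmorphXn !rmorphN /=.
ring.
Qed.

(* A biquadratic polynomial has four distinct roots iff the squares of its
   roots are nonzero and distinct. *)
Lemma four_roots (F : numClosedFieldType) (u v : F) :
  (exists s : seq F, [/\ uniq s, size s = 4%N &
     all (root (('X^2 - u%:P) * ('X^2 - v%:P))) s]) <->
  [/\ u != 0, v != 0 & u != v].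
Proof.
pose p := sqrtC u; pose q := sqrtC v.
have pE : u = p ^+ 2 by rewrite sqrtCK.
have qE : v = q ^+ 2 by rewrite sqrtCK.
have rE x : root (('X^2 - u%:P) * ('X^2 - v%:P)) x = (x \in [:: p; - p; q; - q]).
  by rewrite pE qE char_poly_pairs root_prod_XsubC.
(* Four distinct roots inject into any list that contains p, -p, q, -q. A zero square or two equal
   squares would shorten such a list to at most three entries. *)
have small (s t : seq F) : uniq s -> size s = 4%N ->
    all (root (('X^2 - u%:P) * ('X^2 - v%:P))) s ->
    {subset [:: p; - p; q; - q] <= t} -> (4 <= size t)%N.
  move=> us <- /allP as_ st; apply: uniq_leq_size us _ => x /as_.
  by rewrite rE; exact: st.
split=> [[s [us ss as_]]|[u0 v0 uv]].
  split; apply/eqP => e.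
  - have p0 : p = 0 by rewrite /p e sqrtC0.
    have := small s [:: 0; q; - q] us ss as_; rewrite p0 oppr0.
    by move=> h; suff: (3 < 3)%N by []; apply: h => x; rewrite !inE orbA orbb.
  - have q0 : q = 0 by rewrite /q e sqrtC0.
    have := small s [:: p; - p; 0] us ss as_; rewrite q0 oppr0.
    by move=> h; suff: (3 < 3)%N by []; apply: h => x; rewrite !inE orbb.
  - have pq : q = p by rewrite /q -e.
    have := small s [:: p; - p] us ss as_; rewrite pq.
    by move=> h; suff: (3 < 2)%N by []; apply: h => x; rewrite !inE;
      do 2?[case: (x == _)].
exists [:: p; - p; q; - q]; split=> //; last by apply/allP => x; rewrite rE.
have NN (x y : F) : x ^+ 2 != y ^+ 2 -> (x != y) && (x != - y).
  by rewrite eqf_sqr negb_or.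
have self (x : F) : x ^+ 2 != 0 -> x != - x.
  by rewrite -addr_eq0 -mulr2n mulrn_eq0 expf_eq0.
move: u0 v0 uv; rewrite pE qE => u0 v0 uv.
have /andP[h1 h2] := NN _ _ uv.
have /andP[h3 h4] : (- p != q) && (- p != - q) by apply: NN; rewrite sqrrN.
by rewrite /= !inE !negb_or h1 h2 h3 h4 !self.
Qed.

End MatrixTools.

(** * Linearization at a relative equilibrium *)

Section Linearization.
Variable R : realType.
Notation phase := (phase R).

Section Point.
Variables (w r rho z lam : R).
Hypotheses (lamE : lam = r - rho) (rz : r * z = - w ^+ 2).
Hypotheses (rho0 : rho != 0) (z0 : z != 0).

(** A radical-free form of an equilibrium: with this alpha_3 the equation for omega_2 holds, and
    [rz] is the equation for alpha_2, divided by - rho. The normalization Gamma = 1 is a separate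
    relation, the quadratic equation of alpha_1. *)
Definition eqpoint : phase := mkphase w 0 r (rho * z) 0 (- rho * w).
Local Notation x := eqpoint.

(* The odd directions d/d(omega_2), d/d(alpha_2), followed by their images
   under the linearization of [sgrad H]. *)
Definition leaf_basis : 'M[R]_(4, 6) :=
  \matrix_(i < 4) nth 0 [:: mkphase 0 1 0 0 0 0; mkphase 0 0 0 0 1 0;
     mkphase (rho / 2) 0 0 (rho * w) 0 (rho * z); mkphase 0 0 1 r 0 (- w)] i.

Lemma leaf_basis_free : row_free leaf_basis.
Proof.
apply: inj_row_free => v.
rewrite mulmx_sum_row !big_ord_recl big_ord0 addr0 !rowK /=.
rewrite !mkphaseZ !mkphaseD -(mkphase0 R) => /mkphase_inj[[e1 e2 e3] [_ e5 _]].
rewrite ?mulr0 ?mulr1 ?add0r ?addr0 in e1 e2 e3 e5.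
have e1' : v ord0 (lift ord0 (lift ord0 ord0)) = 0.
  by move/eqP: e1; rewrite !mulf_eq0 (negPf rho0) invr_eq0 pnatr_eq0 /= orbF => /eqP.
apply/rowP => j; rewrite [RHS]mxE.
case: j => -[|[|[|[|//]]]] p; [rewrite -e2|rewrite -e5|rewrite -e1'|rewrite -e3];
  by congr (v _ _); apply/val_inj.
Qed.

Lemma mulmx_leaf_basis (A : 'M[R]_4) (f : 'M[R]_6) :
  (forall i, row i leaf_basis *m f = \sum_k A i k *: row k leaf_basis) ->
  leaf_basis *m f = A *m leaf_basis.
Proof.
move=> h; apply/row_matrixP => i; rewrite row_mul h row_mul mulmx_sum_row.
by apply: eq_bigr => k _; rewrite mxE.
Qed.

Lemma rank_Tleaf : \rank (Tleaf lam x) = 4%N.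
Proof.
have a0 : rho * z != 0 by rewrite mulf_neq0.
rewrite /Tleaf mxrank_ker; set J := jacobian _ _.
suff -> : \rank J = 2%N by [].
apply/eqP/row_fullP.
(* Along d/d(alpha_1), d/d(omega_1) the differentials of Gamma and L form a triangular system with
   diagonal 2 a, a, where a = rho z = alpha_1 <> 0. Its inverse gives the two witnesses. *)
pose u q p : phase := mkphase p 0 0 q 0 0.
exists (\matrix_(i < 2) nth 0 [:: u (rho * z * 2)^-1 (- w * (rho * z * 2)^-1 / (rho *
  z));
                             u 0 (rho * z)^-1] i).
apply/row_matrixP => i; rewrite row_mul rowK row1 /J.
case: i => -[|[|//]] p; rewrite casimirs_row; apply/rowP => j; rewrite !mxE;
  case: j => -[|[|//]] q /=; rewrite /u !mkphaseE; field; rewrite ?rho0 ?z0 //.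
Qed.

Lemma leaf_basis_Tleaf : (leaf_basis :=: Tleaf lam x)%MS.
Proof.
apply/eqmxP.
have s : (leaf_basis <= Tleaf lam x)%MS.
  apply/sub_kermxP/row_matrixP => i; rewrite row_mul rowK row0.
  (* Solving [rz] for r leaves rational identities in the free variables w, rho, z, which [field]
     decides. *)
  have rE : r = - w ^+ 2 / z by rewrite -rz mulfK.
  case: i => -[|[|[|[|//]]]] p; rewrite casimirs_row; apply/rowP => j; rewrite !mxE;
    case: j => -[|[|//]] q /=; rewrite !mkphaseE ?lamE ?rE; field; rewrite ?z0 //.
rewrite s /=; have /leqifP := mxrank_leqif_eq s.
case: ifP => [/andP[_ ->] //|_].
by rewrite rank_Tleaf (eqP leaf_basis_free) ltnn.
Qed.

(** The upper triangular matrix S = [s11, s21; 0, s22] is that of A_H^2 on the odd plane, and N =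
    [n11, n21; 0, n22] is the block of A_K from the odd plane to its image under A_H. The entries
    s11 and s22 become mu_1^2 and mu_2^2. *)
Definition s11 : R := - (rho ^+ 2 + 2 * rho * z) / 4.
Definition s21 : R := w * rho * (z - (3 * r - lam) / 2).
Definition s22 : R := - (w ^+ 2 + r ^+ 2 + rho * z).
Definition n11 : R := 2 * w ^+ 2 + 2 * (r + lam) * (z - lam).
Definition n21 : R := - 4 * w * rho * (z - lam).
Definition n22 : R := 2 * w ^+ 2.

Definition AHmx := antimx 1 0 1 s11 s21 s22.
Definition AKmx := antimx n11 n21 n22 (s11 * n11) (s11 * n21 + s21 * n22) (s22 * n22).

Lemma linz_basis : exists P Q, [/\ P *m Q = 1%:M, Q *m P = 1%:M,
  A_H lam x = P *m AHmx *m Q & A_K lam x = P *m AKmx *m Q].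
Proof.
have [P [Q [PQ QP h]]] := restrictmx_basis leaf_basis_free leaf_basis_Tleaf.
have rE : r = - w ^+ 2 / z by rewrite -rz mulfK.
exists P, Q; split=> //; rewrite /A_H /A_K /linz; apply: h;
  apply: mulmx_leaf_basis => i.
- rewrite sgrad_Ham !big_ord_recl big_ord0 addr0 !rowK /=.
  rewrite !mkphaseZ !mkphaseD !mxE /=.
  rewrite /s11 /s21 /s22.
  case: i => -[|[|[|[|//]]]] p; rewrite mul_jacobian_pfield /= /coord6 /= !mkphaseE;
    congr mkphase; rewrite ?lamE ?rE; field; rewrite ?z0 //.
- rewrite sgrad_Kint !big_ord_recl big_ord0 addr0 !rowK /=.
  rewrite !mkphaseZ !mkphaseD !mxE /=.
  rewrite /s11 /s21 /s22 /n11 /n21 /n22.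
  case: i => -[|[|[|[|//]]]] p; rewrite mul_jacobian_pfield /= /coord6 /= !mkphaseE;
    congr mkphase; rewrite ?lamE ?rE; field; rewrite ?z0 //.
Qed.

End Point.
End Linearization.

(** * Nondegeneracy in terms of S and N *)

Section Nondegeneracy.
Variable R : realType.
Variables (w r rho z lam : R).
Hypotheses (lamE : lam = r - rho) (rz : r * z = - w ^+ 2).
Hypotheses (rho0 : rho != 0) (z0 : z != 0).
Local Notation x := (eqpoint w r rho z).
Local Notation S1 := (s11 rho z).
Local Notation S2 := (s22 w r rho z).

Local Notation N1 := (n11 w r z lam).
Local Notation N12 := (n21 w rho z lam).
Local Notation N2 := (n22 w).

Lemma char_poly_linz a b :
  char_poly (a *: A_H lam x + b *: A_K lam x) =
  ('X^2 - ((a + b * N1) ^+ 2 * S1)%:P) * ('X^2 - ((a + b * N2) ^+ 2 * S2)%:P).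
Proof.
have [P [Q [PQ QP -> ->]]] := linz_basis lamE rz rho0 z0.
rewrite [X in char_poly X](_ : _ =
    P *m (a *: AHmx w r rho z lam + b *: AKmx w r rho z lam) *m Q); last first.
  by rewrite mulmxDr mulmxDl -!scalemxAr -!scalemxAl.
rewrite conj_char_poly // antimx_comb char_poly_antimx.
by congr (('X^2 - _%:P) * ('X^2 - _%:P)); ring.
Qed.

Lemma char_poly_A_H :
  char_poly (A_H lam x) = ('X^2 - S1%:P) * ('X^2 - S2%:P).
Proof.
have := char_poly_linz 1 0.
by rewrite scale1r scale0r !mul0r !addr0 expr1n !mul1r.
Qed.

Lemma det_A_H : \det (A_H lam x) = S1 * S2.
Proof.
have [P [Q [PQ QP -> _]]] := linz_basis lamE rz rho0 z0.
rewrite conj_det //.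
(* The determinant is the constant coefficient of the biquadratic characteristic polynomial; the
   sign is + since the size 4 is even. *)
have := char_poly_det (AHmx w r rho z lam).
rewrite -signr_odd expr0 mul1r => <-.
rewrite char_poly_antimx !mul1r coef0M !coefB !coefXn !coefC /=.
by ring.
Qed.

Lemma eigenvalue_pairs_A_H : exists m1 m2 : R[i],
  [/\ eigenvalue_pairs (x, lam) m1 m2, m1 ^+ 2 = real_complex R S1 &
      m2 ^+ 2 = real_complex R S2].
Proof.
exists (sqrtC (real_complex R S1)), (sqrtC (real_complex R S2)).
split; rewrite ?sqrtCK // /eigenvalue_pairs /complexify -map_char_poly char_poly_A_H.
rewrite -char_poly_pairs !sqrtCK rmorphM !rmorphB /= !map_polyXn !map_polyC //=.
Qed.

Lemma cond_spectrumE : cond_spectrum (x, lam) <->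
  exists a b, [/\ (a + b * N1) ^+ 2 * S1 != 0, (a + b * N2) ^+ 2 * S2 != 0 &
                 (a + b * N1) ^+ 2 * S1 != (a + b * N2) ^+ 2 * S2].
Proof.
have E a b (s : seq R[i]) :
    all (eigenvalue (complexify (a *: A_H lam x + b *: A_K lam x))) s =
    all (root (('X^2 - (real_complex R ((a + b * N1) ^+ 2 * S1))%:P)
             * ('X^2 - (real_complex R ((a + b * N2) ^+ 2 * S2))%:P))) s.
  apply: eq_all => u; rewrite eigenvalue_root_char /complexify -map_char_poly.
  by rewrite char_poly_linz rmorphM !rmorphB /= !map_polyXn !map_polyC.
have inj (u v : R) : (real_complex R u == real_complex R v) = (u == v).
  exact: (inj_eq (fmorph_inj _)).
split=> [[a [b [s [us ss]]]]|[a [b h]]].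
  rewrite E => as_.
  have /four_roots : exists s : seq R[i], [/\ uniq s, size s = 4%N &
     all (root (('X^2 - (real_complex R ((a + b * N1) ^+ 2 * S1))%:P)
             * ('X^2 - (real_complex R ((a + b * N2) ^+ 2 * S2))%:P))) s] by exists s.
  by rewrite -(rmorph0 (real_complex R)) !inj => k; exists a, b.
exists a, b.
have /four_roots[s [us ss as_]] : [/\ real_complex R ((a + b * N1) ^+ 2 * S1) != 0,
    real_complex R ((a + b * N2) ^+ 2 * S2) != 0 &
    real_complex R ((a + b * N1) ^+ 2 * S1) != real_complex R ((a + b * N2) ^+ 2 * S2)].
  by rewrite -(rmorph0 (real_complex R)) !inj.
by exists s; rewrite E.
Qed.

Lemma cond_indepE : cond_indep (x, lam) <-> (N12 != 0 \/ N1 != N2).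
Proof.
rewrite /cond_indep /=.
have [P [Q [PQ QP -> ->]]] := linz_basis lamE rz rho0 z0.
have E a b : a *: (P *m AHmx w r rho z lam *m Q) + b *: (P *m AKmx w r rho z lam *m Q) =
    P *m (a *: AHmx w r rho z lam + b *: AKmx w r rho z lam) *m Q.
  by rewrite mulmxDr mulmxDl -!scalemxAr -!scalemxAl.
rewrite free2P; split=> [h|h a b].
  have [n0|n0] := eqVneq N12 0; last by left.
  right; apply/eqP => n1.
  (* Freeness is tested on the coefficients (N1, -1): when N is scalar, A_K = N1 A_H. *)
  have [_ /eqP] : N1 = 0 /\ -1 = 0 :> R; last by rewrite oppr_eq0 oner_eq0.
  apply: h; rewrite E antimx_comb n0 -n1.
  rewrite (_ : antimx _ _ _ _ _ _ = 0) ?mulmx0 ?mul0mx //.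
  apply/matrixP => i j; rewrite !mxE.
  by case: i => -[|[|[|[|//]]]] ?; case: j => -[|[|[|[|//]]]] ? //=; ring.
rewrite E => /(conj_eq0 QP); rewrite antimx_comb => /antimx_eq0.
rewrite !mulr1 mulr0 add0r => -[e1 e12 e2].
suff b0 : b = 0 by move: e1; rewrite b0 mul0r addr0.
case: h => h; first by apply/eqP; move/eqP: e12; rewrite mulf_eq0 (negPf h) orbF.
have /eqP : b * (N1 - N2) = 0.
  by apply/eqP; rewrite mulrBr subr_eq0 -(inj_eq (addrI a)) e1 e2.
by rewrite mulf_eq0 subr_eq0 (negPf h) orbF => /eqP.
Qed.

Hypothesis lam0 : lam != 0.

Lemma w0_r0 : w = 0 -> r = 0.
Proof.
move=> w0; move: rz; rewrite w0 expr0n oppr0 => /eqP.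
by rewrite mulf_eq0 (negPf z0) orbF => /eqP.
Qed.

(** Both n21 and n11 - n22 contain the factor z - lam. The cofactor of n21 is nonzero when w <> 0;
    when w = 0 also r = 0, and n11 - n22 = 2 lam (z - lam). *)
Lemma cond_indep_iff : cond_indep (x, lam) <-> z != lam.
Proof.
rewrite cond_indepE; split=> [h|zl].
  apply/eqP => e; case: h => /eqP; apply; rewrite /n21 /n11 /n22 e; ring.
have [w0|w0] := eqVneq w 0.
  right; have r0 := w0_r0 w0.
  rewrite -subr_eq0 /n11 /n22 w0 r0.
  rewrite (_ : _ - _ = 2 * (lam * (z - lam))); last by ring.
  by rewrite !mulf_neq0 ?pnatr_eq0 // subr_eq0.
left; rewrite /n21 !mulf_neq0 ?oppr_eq0 ?pnatr_eq0 // subr_eq0 //.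
Qed.

Lemma nondegenerate_iff : is_nondegenerate (x, lam) <->
  [/\ S1 != 0, S2 != 0, r + lam != 0 & z != lam].
Proof.
rewrite /is_nondegenerate cond_indep_iff cond_spectrumE.
split=> [[zl [a [b [h1 h2 h12]]]]|[h1 h2 rl zl]].
  split=> //.
  - by apply: contraNneq h1 => ->; rewrite mulr0.
  - by apply: contraNneq h2 => ->; rewrite mulr0.
  (* S1 - S2 = (r + lam) ((3 r - lam) / 4 - z / 2), so r = - lam makes both S1 = S2 and N1 = N2,
     whatever a and b are. *)
  apply: contraNneq h12 => e.
  have lE : lam = - r by lra.
  have rhoE : rho = 2 * r by rewrite -[LHS](subKr r) -lamE lE; ring.
  have -> : N1 = N2 by rewrite /n11 /n22 e; ring.
  suff -> : S1 = S2 by [].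
  rewrite /s11 /s22 rhoE (_ : w ^+ 2 = - (r * z)); last by rewrite rz opprK.
  by field.
split=> //.
have n12 : N1 - N2 != 0.
  rewrite (_ : N1 - N2 = 2 * ((r + lam) * (z - lam))); last by rewrite /n11 /n22; ring.
  by rewrite !mulf_neq0 ?pnatr_eq0 // subr_eq0.
(* Since N1 <> N2, the values a + b N1 and a + b N2 can be prescribed. They are taken to be p and 1,
   with p = 2 if S1 = S2 and p = 1 otherwise. *)
have [p [p0 hp]] : exists p : R, p != 0 /\ p ^+ 2 * S1 != S2.
  have [e|e] := eqVneq S1 S2; last by exists 1; rewrite oner_neq0 expr1n mul1r.
  exists 2; rewrite pnatr_eq0 -e; split=> //.
  rewrite -subr_eq0 (_ : _ - _ = 3 * S1); last by ring.
  by rewrite mulf_neq0 ?pnatr_eq0.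
pose b := (p - 1) / (N1 - N2).
exists (1 - b * N2), b.
have -> : 1 - b * N2 + b * N1 = p by rewrite -addrA [- _ + _]addrC -mulrBr divfK //;
  ring.
rewrite subrK expr1n mul1r; split=> //.
by rewrite mulf_neq0 // expf_neq0.
Qed.

End Nondegeneracy.

(** * The three families and the quadratic equation of alpha_1 *)

Section Equilibria.
Variable R : realType.
Implicit Types (i : equil_family) (r lam : R).

Definition al1_of i r lam : R := (r * (r - lam) - d_of i r lam) / 2.

Lemma d_of_sqr i r lam : d_of i r lam ^+ 2 = (r * (r - lam)) ^+ 2 + 4.
Proof.
have h : 0 <= r ^+ 2 * (r - lam) ^+ 2 + 4.
  by rewrite addr_ge0 ?ler0n // mulr_ge0 // sqr_ge0.
by case: i; rewrite /d_of ?sqrrN sqr_sqrtr // exprMn.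
Qed.

Lemma d_of_gt r lam : `|r * (r - lam)| < d_of F2 r lam.
Proof.
have d0 : 0 <= d_of F2 r lam by exact: sqrtr_ge0.
rewrite -(@ltr_pXn2r _ 2) ?nnegrE // real_normK ?num_real // d_of_sqr.
lra.
Qed.

Lemma al1_of_sqr i r lam :
  al1_of i r lam ^+ 2 = r * (r - lam) * al1_of i r lam + 1.
Proof.
rewrite /al1_of; have := d_of_sqr i r lam; set d := d_of _ _ _ => h.
rewrite [X in _ = _ + X](_ : 1 = (d ^+ 2 - (r * (r - lam)) ^+ 2) / 4);
  last by rewrite h; field.
by field.
Qed.

Definition al1_sign i (a : R) : Prop := match i with F1 => 0 < a | _ => a < 0 end.

Lemma al1_of_sign i r lam : al1_sign i (al1_of i r lam).
Proof.
have := d_of_gt r lam; rewrite ltr_norml => /andP[h1 h2].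
have d1 : d_of F1 r lam = - d_of F2 r lam by [].
have d3 : d_of F3 r lam = d_of F2 r lam by [].
by case: i => /=; rewrite /al1_of ?d1 ?d3; lra.
Qed.

Lemma al1_of_neq0 i r lam : al1_of i r lam != 0.
Proof. by have := al1_of_sign i r lam; case: i => /=; lra. Qed.

(** The two roots of the quadratic have product -1, hence opposite signs, so the sign prescribed by
    the family singles out one of them. *)
Lemma al1_of_uniq i r lam a : al1_sign i a -> a ^+ 2 = r * (r - lam) * a + 1 ->
  a = al1_of i r lam.
Proof.
move=> sa aE; have sb := al1_of_sign i r lam; have bE := al1_of_sqr i r lam.
move: (al1_of i r lam) sb bE => b sb bE.
have ab : 0 < a * b by case: i sa sb => /= *;
  [exact: mulr_gt0|rewrite nmulr_rgt0|rewrite nmulr_rgt0].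
have : (a - b) * (a * b + 1) = 0.
  have -> : (a - b) * (a * b + 1) = a ^+ 2 * b - a * b ^+ 2 + a - b by ring.
  by rewrite aE bE; ring.
move/eqP; rewrite mulf_eq0 => /orP[|/eqP]; last lra.
by rewrite subr_eq0 => /eqP.
Qed.

Section Family.
Variables (i : equil_family) (r lam : R).
Hypothesis hd : delta_reg i (r, lam).

Lemma delta_lam : 0 < lam.
Proof. by case: i hd => /= -[]; lra. Qed.

Lemma delta_rho : r - lam != 0.
Proof. by case: i hd => /= -[] *; rewrite subr_eq0; apply/eqP; lra. Qed.

Lemma delta_radicand : 0 <= - (r * (al1_of i r lam / (r - lam))).
Proof.
have h := al1_of_sign i r lam; have r0 := delta_rho.
rewrite oppr_ge0 mulrA.
case: i hd h => /= -[h1 h2] h.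
- rewrite ler_ndivrMr ?mul0r; last lra.
  by rewrite mulr_ge0 // ltW.
- rewrite ler_ndivrMr ?mul0r; last lra.
  by rewrite mulr_le0 // ltW.
- rewrite ler_pdivrMr ?mul0r; last lra.
  by rewrite mulr_ge0_le0 //; lra.
Qed.

Lemma V_of_radicand : V_of i r lam = Num.sqrt (- (r * (al1_of i r lam / (r - lam)))).
Proof. by rewrite /V_of /al1_of; congr Num.sqrt; field; exact: delta_rho. Qed.

Lemma V_of_sqr : V_of i r lam ^+ 2 = - (r * (al1_of i r lam / (r - lam))).
Proof. by rewrite V_of_radicand sqr_sqrtr // delta_radicand. Qed.

Lemma V_of_gt0 : r != 0 -> 0 < V_of i r lam.
Proof.
move=> r0; rewrite lt_def sqrtr_ge0 andbT -sqrf_eq0 V_of_sqr.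
by rewrite oppr_eq0 mulf_neq0 // mulf_neq0 ?al1_of_neq0 // invr_eq0 delta_rho.
Qed.

Lemma xi_eqpoint s : xi i s r lam =
  eqpoint ((-1) ^+ s * V_of i r lam) r (r - lam) (al1_of i r lam / (r - lam)).
Proof.
rewrite /xi /eqpoint -/(al1_of i r lam).
by congr mkphase; field; exact: delta_rho.
Qed.

Lemma xi_w2 s : r * (al1_of i r lam / (r - lam)) =
  - ((-1) ^+ s * V_of i r lam) ^+ 2.
Proof. by rewrite exprMn sqrr_sign mul1r V_of_sqr opprK. Qed.

Lemma z_neq0 : al1_of i r lam / (r - lam) != 0.
Proof. by rewrite mulf_neq0 ?al1_of_neq0 // invr_eq0 delta_rho. Qed.

Lemma mu1sqE : mu1sq i r lam = - ((r - lam) ^+ 2 + 2 * al1_of i r lam) / 4.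
Proof. by rewrite /mu1sq /al1_of; field. Qed.

Lemma mu2sqE : mu2sq i r lam = (lam * al1_of i r lam - r ^+ 2 * (r - lam)) / (r - lam).
Proof. by rewrite /mu2sq /al1_of; field; exact: delta_rho. Qed.

Lemma s11_mu1 : s11 (r - lam) (al1_of i r lam / (r - lam)) = mu1sq i r lam.
Proof. by rewrite mu1sqE /s11; field; exact: delta_rho. Qed.

Lemma s22_mu2 s : s22 ((-1) ^+ s * V_of i r lam) r (r - lam)
  (al1_of i r lam / (r - lam)) = mu2sq i r lam.
Proof.
rewrite mu2sqE /s22 exprMn sqrr_sign mul1r V_of_sqr.
by field; exact: delta_rho.
Qed.

Let lamE : lam = r - (r - lam).
Proof. by rewrite subKr. Qed.

Lemma xi_nondegenerate s : is_nondegenerate (xi_ext i s r lam) <->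
  [/\ mu1sq i r lam != 0, mu2sq i r lam != 0, r + lam != 0 &
      al1_of i r lam != lam * (r - lam)].
Proof.
rewrite /xi_ext xi_eqpoint.
have := nondegenerate_iff lamE (xi_w2 s) delta_rho z_neq0 (lt0r_neq0 delta_lam).
rewrite s11_mu1 s22_mu2 => ->.
by rewrite (can2_eq (divfK delta_rho) (mulfK delta_rho)).
Qed.

Lemma xi_cond_indep s : cond_indep (xi_ext i s r lam) <->
  al1_of i r lam != lam * (r - lam).
Proof.
rewrite /xi_ext xi_eqpoint.
have := cond_indep_iff lamE (xi_w2 s) delta_rho z_neq0 (lt0r_neq0 delta_lam).
by move=> ->; rewrite (can2_eq (divfK delta_rho) (mulfK delta_rho)).
Qed.

Lemma xi_det s : \det (A_H lam (xi i s r lam)) = mu1sq i r lam * mu2sq i r lam.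
Proof.
by rewrite xi_eqpoint (det_A_H lamE (xi_w2 s) delta_rho z_neq0) s11_mu1 s22_mu2.
Qed.

Lemma xi_eigenvalues s : exists m1 m2 : R[i],
  [/\ eigenvalue_pairs (xi_ext i s r lam) m1 m2,
      m1 ^+ 2 = real_complex R (mu1sq i r lam) &
      m2 ^+ 2 = real_complex R (mu2sq i r lam)].
Proof.
have := eigenvalue_pairs_A_H lamE (xi_w2 s) delta_rho z_neq0.
by rewrite s11_mu1 s22_mu2 /xi_ext xi_eqpoint.
Qed.

Lemma xi_rel_equilibrium s : rel_equilibria lam (xi i s r lam).
Proof.
rewrite /rel_equilibria /P5 /= /Gam /gyrostat /xi !mkphaseE.
rewrite -/(al1_of i r lam).
have wE := xi_w2 s; have aE := al1_of_sqr i r lam.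
set w := (-1) ^+ s * _ in wE *; set a := al1_of i r lam in wE aE *.
have raE : r * a = - (w ^+ 2 * (r - lam)).
  by rewrite -mulNr -wE -mulrA divfK ?delta_rho.
split.
  rewrite (_ : _ + _ = a ^+ 2 + (r - lam) * (w ^+ 2 * (r - lam))); last by ring.
  by rewrite aE -[w ^+ 2 * _]opprK -raE; ring.
rewrite -(mkphase0 R); congr mkphase; try by field.
rewrite (_ : _ - _ = - (r * a) - w ^+ 2 * (r - lam)); last by ring.
by rewrite raE opprK subrr.
Qed.

End Family.

Lemma rel_equilibriaE lam : 0 < lam ->
  rel_equilibria lam = Rfam F1 lam `|` Rfam F2 lam `|` Rfam F3 lam.
Proof.
move=> lam0; apply/seteqP; split=> x; last first.
  by move=> [[|]|] [s [r [hd ->]]]; apply: xi_rel_equilibrium.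
rewrite (mkphase_eta x); move: (om1 x) (om2 x) (om3 x) (al1 x) (al2 x) (al3 x).
move=> w w2 r a a2 a3.
rewrite /rel_equilibria /P5 /= /Gam /gyrostat !mkphaseE => -[hG].
rewrite -(mkphase0 R) => /mkphase_inj [[e1 e2 e3] [e4 e5 e6]].
subst a2.
(* Both alpha_1 and alpha_3 annihilate omega_2, while alpha_2 = 0 and alpha is a unit vector. *)
have w20 : w2 = 0.
  have h3 : a3 * w2 = 0 by lra.
  have h1 : a * w2 = 0 by lra.
  have : (a ^+ 2 + 0 ^+ 2 + a3 ^+ 2) * w2 = 0.
    rewrite (_ : _ * _ = a * (a * w2) + a3 * (a3 * w2)); last by ring.
    by rewrite h1 h3; ring.
  by rewrite hG mul1r.
subst w2.
have a3E : a3 = - (r - lam) * w by lra.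
have raE : r * a = - (w ^+ 2 * (r - lam)).
  have -> : r * a = a3 * w by lra.
  by rewrite a3E; ring.
(* At r = lam all components of alpha would vanish, against Gamma = 1. *)
have rho0 : r - lam != 0.
  apply/eqP => e.
  have rE : r = lam by lra.
  have : a = 0.
    move/eqP: raE; rewrite e mulr0 oppr0 mulf_eq0 rE (gt_eqF lam0) /=.
    by move/eqP.
  by move=> a0; move: hG; rewrite a3E e a0; lra.
have aE : a ^+ 2 = r * (r - lam) * a + 1.
  rewrite -hG a3E (_ : r * (r - lam) * a = (r - lam) * (r * a)); last by ring.
  by rewrite raE; ring.
have a0 : a != 0.
  by apply/eqP => e; move: aE; rewrite e; lra.
suff [i [hd sa]] : exists i, delta_reg i (r, lam) /\ al1_sign i a.
  have E := al1_of_uniq sa aE.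
  have wE : w ^+ 2 = V_of i r lam ^+ 2.
    by rewrite V_of_sqr // -E mulrA raE mulNr mulfK ?opprK.
  suff : Rfam i lam (mkphase w 0 r a 0 a3).
    by case: i {hd sa E wE}; [left;left|left;right|right].
  move/eqP: wE; rewrite eqf_sqr => /orP[/eqP wE|/eqP wE].
    exists false, r; split=> //; rewrite /xi -/(al1_of i r lam) -E.
    by rewrite expr0 mul1r a3E wE.
  exists true, r; split=> //; rewrite /xi -/(al1_of i r lam) -E.
  by rewrite expr1 mulN1r a3E wE.
(* The relation r alpha_1 = - w^2 (r - lam) leaves only the three families: alpha_1 < 0 < r forces r
   > lam, and alpha_1 > 0 forces 0 <= r < lam. *)
have w2 : 0 <= w ^+ 2 by exact: sqr_ge0.
have [a_lt0|a_gt0|/eqP] := ltgtP a 0; last by rewrite (negPf a0).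
- have [r_le0|r_gt0] := lerP r 0; first by exists F2.
  have : r * a < 0 by rewrite pmulr_rlt0.
  rewrite raE oppr_lt0 => h.
  have [rl|rl] := ltrP lam r; first by exists F3.
  by move: h; rewrite ltNge mulr_ge0_le0 // subr_le0.
- have [r_lt0|r_ge0] := ltrP r 0.
    have : r * a < 0 by rewrite pmulr_llt0.
    rewrite raE oppr_lt0 ltNge mulr_ge0_le0 //; lra.
  exists F1; split=> //; split=> //=.
  have : 0 <= r * a by rewrite mulr_ge0 // ltW.
  rewrite raE oppr_ge0 => h; rewrite ltNge; apply/negP => lr.
  have r_gt0 : 0 < r by lra.
  have : 0 < r * a by rewrite mulr_gt0.
  by rewrite raE oppr_gt0 ltNge mulr_ge0 // subr_ge0.
Qed.

End Equilibria.

(** * Curves and regions *)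

Section Curves.
Variable R : realType.
Implicit Types (i : equil_family) (k : region) (c : curve) (r lam : R).

(* [Pi23] and [Pi31] are two arcs of the same algebraic curve. *)
Definition curve_fun c r lam : R :=
  match c with
  | Pi21 => lam * (lam - r) ^+ 3 - 1
  | Pi22 => r + lam
  | Pi24 => (r * (r - lam)) ^+ 3 - lam ^+ 2
  | _ => (lam - r) ^+ 3 * (lam - 3 * r) - 4
  end.

Lemma powR_pow3 (lam : R) (p : R) : 0 <= lam -> (lam `^ p) ^+ 3 = lam `^ (p * 3).
Proof. by move=> l0; rewrite -powR_mulrn ?powR_ge0 // -powRrM. Qed.

Lemma powR13K (lam : R) : 0 < lam -> (lam `^ (- 3^-1)) ^+ 3 = lam^-1.
Proof.
move=> l0; rewrite powR_pow3 ?ltW // mulNr mulVf ?pnatr_eq0 //.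
by rewrite powR_inv1 // ltW.
Qed.

Lemma powR23K (lam : R) : 0 < lam -> (lam `^ (2 / 3)) ^+ 3 = lam ^+ 2.
Proof.
by move=> l0; rewrite powR_pow3 ?ltW // divfK ?pnatr_eq0 // powR_mulrn // ltW.
Qed.

Lemma powR14K : ((4 / 3) `^ (4^-1)) ^+ 4 = 4 / 3 :> R.
Proof.
have h : 0 <= 4 / 3 :> R by rewrite divr_ge0.
by rewrite -powR_mulrn ?powR_ge0 // -powRrM mulVf ?pnatr_eq0 // powRr1.
Qed.

Lemma sqrt2_pow4 : Num.sqrt 2 ^+ 4 = 4 :> R.
Proof. by rewrite (exprM _ 2 2) sqr_sqrtr //; ring. Qed.

Lemma pi21E r lam : 0 < lam -> (r = lam - lam `^ (- 3^-1)) <-> curve_fun Pi21 r lam = 0.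
Proof.
move=> l0; have q0 : 0 < lam `^ (- 3^-1) by exact: powR_gt0.
have q3 := powR13K l0; set q := lam `^ _ in q0 q3 *.
have l1 : lam != 0 by exact: lt0r_neq0.
split=> [->|/eqP /=].
  by rewrite /= subKr q3 mulfV // subrr.
rewrite subr_eq0 => /eqP e.
have y3 : (lam - r) ^+ 3 = q ^+ 3 by rewrite q3 -[RHS]mulr1 -e mulKf.
suff : lam - r = q by move=> <-; rewrite subKr.
have y0 : 0 <= lam - r.
  rewrite leNgt; apply/negP => n.
  have : (lam - r) ^+ 3 < 0 by rewrite exprn_odd_lt0.
  by rewrite y3 ltNge exprn_ge0 // ltW.
by apply: (pexpIrn (n := 3)) => //; rewrite nnegrE // ltW.
Qed.

(** Cubing removes the fractional power and preserves order, both sides being nonnegative for r <= 0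
    < lam. *)
Lemma pi24_cmp r lam : r <= 0 -> 0 < lam ->
  (r * (r - lam) < lam `^ (2 / 3)) = (curve_fun Pi24 r lam < 0) /\
  (lam `^ (2 / 3) < r * (r - lam)) = (0 < curve_fun Pi24 r lam).
Proof.
move=> r0 l0; rewrite /= subr_lt0 subr_gt0 -powR23K //.
have h : 0 <= r * (r - lam) by rewrite mulr_le0 //; lra.
by rewrite !ltr_pXn2r // nnegrE ?powR_ge0.
Qed.

(** The explicit bounds in the curves are the region constraints in disguise. On [Pi23] and [Pi31]
    the parameter is sigma = lam - r, where sigma^4 <= 4 encodes r <= 0 for sigma > 0, and
    comparison of sigma^4 with 4/3 encodes lam > 0. On [Pi21], lam <= 1 encodes r <= 0; [Pi24] picks
    the nonpositive root of r (r - lam) = lam^(2/3). *)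
Lemma curve_setE c r lam : curve_set c (r, lam) <->
  delta_reg (curve_family c) (r, lam) /\ curve_fun c r lam = 0.
Proof.
case: c => /=.
- split=> [[e /andP[l0 l1]]|[[r0 l0] /(pi21E _ l0) e]].
    have /(pi21E _ l0) h := e; split=> //; split=> //.
    rewrite e subr_le0; have q0 := powR_gt0 (- 3^-1) l0.
    rewrite -(@ler_pXn2r _ 3) ?nnegrE ?(ltW q0) ?(ltW l0) // powR13K //.
    apply: (@le_trans _ _ 1); last by rewrite invf_ge1.
    by apply: exprn_ile1 => //; exact: ltW.
  split=> //; rewrite l0 /=; rewrite leNgt; apply/negP => l1.
  have q0 := powR_gt0 (- 3^-1) l0.
  have : lam <= lam `^ (- 3^-1) by rewrite -subr_le0 -e.
  rewrite -(@ler_pXn2r _ 3) ?nnegrE ?(ltW q0) ?(ltW l0) // powR13K // leNgt.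
  by rewrite (@lt_trans _ _ 1) ?invf_lt1 // exprn_egt1.
- by split=> [[-> l0]|[[r0 l0] e]]; split=> //; lra.
- split=> [[sg [/andP[s1 s2] -> ->]]|[[r0 l0] e]].
    have s0 : 0 < sg by apply: le_lt_trans s1; exact: powR_ge0.
    have h1 : 4 / 3 < sg ^+ 4 by rewrite -powR14K ltr_pXn2r ?nnegrE ?powR_ge0 ?(ltW s0).
    have h2 : sg ^+ 4 <= 4 by rewrite -sqrt2_pow4 ler_pXn2r ?nnegrE ?sqrtr_ge0 ?(ltW
      s0).
    have s3 : 0 < 2 * sg ^+ 3 by rewrite mulr_gt0 // exprn_gt0.
    split; [split|].
    + by rewrite pmulr_lle0 ?invr_gt0 // subr_le0.
    + by rewrite divr_gt0 // ; lra.
    + by field; exact: lt0r_neq0.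
  have y0 : 0 < lam - r by lra.
  have y3 : 0 < 2 * (lam - r) ^+ 3 by rewrite mulr_gt0 // exprn_gt0.
  have E1 : 3 * (lam - r) ^+ 4 - 4 = lam * (2 * (lam - r) ^+ 3).
    by apply/eqP; rewrite -subr_eq0 -e; apply/eqP; ring.
  have E2 : (lam - r) ^+ 4 - 4 = r * (2 * (lam - r) ^+ 3).
    by apply/eqP; rewrite -subr_eq0 -e; apply/eqP; ring.
  exists (lam - r); rewrite E1 E2 !mulfK ?lt0r_neq0 //; split=> //.
  have p1 : 0 < lam * (2 * (lam - r) ^+ 3) by rewrite mulr_gt0.
  have p2 : r * (2 * (lam - r) ^+ 3) <= 0 by rewrite mulr_le0_ge0 // ltW.
  rewrite -(@ltr_pXn2r _ 4) ?nnegrE ?powR_ge0 ?(ltW y0) // powR14K.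
  rewrite -(@ler_pXn2r _ 4) ?nnegrE ?sqrtr_ge0 ?(ltW y0) // sqrt2_pow4.
  by apply/andP; split; lra.
- set L := lam `^ _; split=> [[rE l0]|[[r0 l0] e]].
    have L0 : 0 < L by exact: powR_gt0.
    have L3 : L ^+ 3 = lam ^+ 2 by exact: powR23K.
    set S := Num.sqrt _ in rE.
    have S2 : S ^+ 2 = lam ^+ 2 + 4 * L by rewrite sqr_sqrtr // addr_ge0 ?sqr_ge0 //
      mulr_ge0 // ltW.
    have lS : lam <= S.
      rewrite -(@ler_pXn2r _ 2) ?nnegrE ?sqrtr_ge0 ?(ltW l0) // S2; lra.
    split; first by split=> //; lra.
    have -> : r * (r - lam) = L.
      rewrite rE (_ : _ * _ = (S ^+ 2 - lam ^+ 2) / 4); last by field.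
      by rewrite S2; field.
    by rewrite L3 subrr.
  have L0 : 0 < L by exact: powR_gt0.
  have rL : r * (r - lam) = L.
    have [h1 h2] := pi24_cmp r0 l0; rewrite -/L /= e ltxx in h1 h2.
    by apply/eqP; rewrite eq_le !leNgt h1 h2.
  split=> //.
  rewrite (_ : lam ^+ 2 + 4 * L = (lam - 2 * r) ^+ 2); last by rewrite -rL; ring.
  by rewrite sqrtr_sqr ger0_norm; [field|lra].
- split=> [[sg [/andP[s1 s2] -> ->]]|[[l0 r0] e]].
    have n0 : 0 < - sg by lra.
    have h1 : sg ^+ 4 < 4 / 3.
      rewrite (_ : sg ^+ 4 = (- sg) ^+ 4); last by ring.
      rewrite -powR14K ltr_pXn2r ?nnegrE ?powR_ge0 ?(ltW n0) //; lra.
    have s3 : 2 * sg ^+ 3 < 0.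
      by rewrite pmulr_rlt0 // exprn_odd_lt0.
    have sn0 : sg != 0 by lra.
    have l0 : 0 < (3 * sg ^+ 4 - 4) / (2 * sg ^+ 3).
      by rewrite nmulr_rgt0 ?invr_lt0 //; lra.
    split; [split|].
    + by [].
    + rewrite -subr_gt0 (_ : _ - _ = - sg) //; by field.
    + by field.
  have y0 : lam - r < 0 by lra.
  have y3 : 2 * (lam - r) ^+ 3 < 0 by rewrite pmulr_rlt0 // exprn_odd_lt0.
  have E1 : 3 * (lam - r) ^+ 4 - 4 = lam * (2 * (lam - r) ^+ 3).
    by apply/eqP; rewrite -subr_eq0 -e; apply/eqP; ring.
  have E2 : (lam - r) ^+ 4 - 4 = r * (2 * (lam - r) ^+ 3).
    by apply/eqP; rewrite -subr_eq0 -e; apply/eqP; ring.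
  exists (lam - r); rewrite E1 E2 !mulfK ?ltr0_neq0 //; split=> //.
  have p1 : lam * (2 * (lam - r) ^+ 3) < 0 by rewrite pmulr_rlt0.
  rewrite y0 andbT ltrNl.
  rewrite -(@ltr_pXn2r _ 4) ?nnegrE ?powR_ge0 //; last lra.
  rewrite powR14K (_ : (- (lam - r)) ^+ 4 = (lam - r) ^+ 4); last by ring.
  by lra.
Qed.

(** The sign table of the curve functions over the regions, [true] meaning positive; it is
    meaningful when [k] and [c] belong to the same family. In the second family the other three
    curves are ordered on each side of r = - lam, so four patterns occur on each side. *)
Definition sign_pos k c : bool :=
  match k, c with
  | D21, Pi22 | D26, (Pi22 | Pi21) | D27, (Pi22 | Pi21 | Pi23)
  | D28, _ | D23, Pi24 | D24, (Pi24 | Pi23) | D25, (Pi24 | Pi23 | Pi21)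
  | D32, _ => true
  | _, _ => false
  end.

Definition has_bsign (b : bool) (u : R) : Prop := if b then 0 < u else u < 0.

(* This identity and the next order the curves of the second family on either
   side of [r = - lam]. *)
Lemma curve_fun_21_23 r lam :
  lam * curve_fun Pi23 r lam =
  (lam - 3 * r) * curve_fun Pi21 r lam - 3 * curve_fun Pi22 r lam.
Proof. by rewrite /=; ring. Qed.

Lemma curve_fun_23_24 r lam :
  curve_fun Pi24 r lam * (lam - 3 * r) =
  (- r) ^+ 3 * curve_fun Pi23 r lam - curve_fun Pi22 r lam * (lam - 2 * r) ^+ 2.
Proof. by rewrite /=; ring. Qed.

(** Every implication is read off from one of the two preceding identities, whose coefficients have
    known signs. The last four recover the side of r = - lam for the regions whose inequalities do
    not mention it. *)
Lemma curve_fun_order r lam : delta_reg F2 (r, lam) ->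
  let c21 := curve_fun Pi21 r lam in let c22 := curve_fun Pi22 r lam in
  let c23 := curve_fun Pi23 r lam in let c24 := curve_fun Pi24 r lam in
  [/\ (0 < c22 -> (c21 < 0 -> c23 < 0) /\ (c23 < 0 -> c24 < 0)),
      (0 < c22 -> (0 < c24 -> 0 < c23) /\ (0 < c23 -> 0 < c21)),
      (c22 < 0 -> (c24 < 0 -> c23 < 0) /\ (c23 < 0 -> c21 < 0)) &
      (c22 < 0 -> (0 < c21 -> 0 < c23) /\ (0 < c23 -> 0 < c24))] /\
  [/\ (c23 < 0 -> 0 < c24 -> c22 < 0), (0 < c23 -> c21 < 0 -> c22 < 0),
      (c23 < 0 -> 0 < c21 -> 0 < c22) & (0 < c23 -> c24 < 0 -> 0 < c22)].
Proof.
move=> [r0 l0] c21 c22 c23 c24; rewrite /fst /snd in r0 l0.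
have kA : lam * c23 = (lam - 3 * r) * c21 - 3 * c22 := curve_fun_21_23 r lam.
have kB : c24 * (lam - 3 * r) = (- r) ^+ 3 * c23 - c22 * (lam - 2 * r) ^+ 2 :=
  curve_fun_23_24 r lam.
have p0 : 0 < lam - 3 * r by lra.
have q0 : 0 <= (- r) ^+ 3 by rewrite exprn_ge0 // oppr_ge0.
have s0 : 0 < (lam - 2 * r) ^+ 2 by rewrite exprn_gt0 //; lra.
(* Only the signs of the coefficients matter from here on. As q = (- r)^3 vanishes at r = 0, it
   yields only the one-way facts [M7] to [M10]. *)
move: {r0} (lam - 3 * r) ((- r) ^+ 3) ((lam - 2 * r) ^+ 2) p0 q0 s0 kA kB => p q s.
move: c21 c22 c23 c24 => A B C D p0 q0 s0 kA kB.
have M1 u : (0 < lam * u) = (0 < u) by rewrite pmulr_rgt0.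
have M2 u : (lam * u < 0) = (u < 0) by rewrite pmulr_rlt0.
have M3 u : (0 < p * u) = (0 < u) by rewrite pmulr_rgt0.
have M4 u : (p * u < 0) = (u < 0) by rewrite pmulr_rlt0.
have M5 u : (0 < u * s) = (0 < u) by rewrite pmulr_lgt0.
have M6 u : (u * s < 0) = (u < 0) by rewrite pmulr_llt0.
have M7 : 0 < q * C -> 0 < C.
  by move=> h; rewrite ltNge; apply/negP => c; move: h; rewrite ltNge mulr_ge0_le0.
have M8 : q * C < 0 -> C < 0.
  by move=> h; rewrite ltNge; apply/negP => c; move: h; rewrite ltNge mulr_ge0.
have M9 : 0 < C -> 0 <= q * C by move=> c; rewrite mulr_ge0 // ltW.
have M10 : C < 0 -> q * C <= 0 by move=> c; rewrite mulr_ge0_le0 // ltW.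
have kB' : p * D = q * C - B * s by rewrite -kB mulrC.
rewrite -!(M5 B) -!(M6 B).
split; split; try (move=> b; split); move=> h; try (move=> h').
- by rewrite -[C < 0]M2 kA; move: b h; rewrite M5 -[A < 0]M4; lra.
- by have := M10 h; rewrite -M4 kB'; lra.
- by apply: M7; move: h; rewrite -M3 kB'; lra.
- by rewrite -M3; move: b h; rewrite M5 -[0 < C]M1 kA; lra.
- by apply: M8; move: h; rewrite -M4 kB'; lra.
- by rewrite -M4; move: b h; rewrite M6 -[C < 0]M2 kA; lra.
- by rewrite -[0 < C]M1 kA; move: b h; rewrite M6 -[0 < A]M3; lra.
- by have := M9 h; rewrite -M3 kB'; lra.
- by have := M10 h; move: h'; rewrite -M3 kB'; lra.
- by rewrite M6; move: h h'; rewrite -M1 kA -M4; lra.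
- by rewrite M5; move: h h'; rewrite -M2 kA -M3; lra.
- by have := M9 h; move: h'; rewrite -M4 kB'; lra.
Qed.

(** A region of the second family is given by two inequalities; the order of the curves supplies the
    two missing signs, and conversely the table contains the two given ones. *)
Lemma region_setE k r lam : region_set k (r, lam) <->
  delta_reg (region_family k) (r, lam) /\
  forall c, curve_family c = region_family k ->
    has_bsign (sign_pos k c) (curve_fun c r lam).
Proof.
have F2case c : curve_family c = F2 -> [\/ c = Pi21, c = Pi22, c = Pi23 | c = Pi24].
  by case: c => // _; [constructor 1|constructor 2|constructor 3|constructor 4].
have rE : (lam - r) ^+ 3 * (lam - 3 * r) = (r - lam) ^+ 3 * (3 * r - lam) by ring.
rewrite /region_set /=.
split=> -[hd h]; split=> //.
- have [k2|k2] : region_family k = F2 \/ region_family k <> F2.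
    by case: (k); by [left | right].
  + move: (hd); rewrite k2 => hd2.
    have := curve_fun_order hd2; have [L1 L2] := pi24_cmp hd2.1 hd2.2.
    case=> -[ o1 o2 o3 o4] [ o5 o6 o7 o8] c.
    have [s1 s2 s3 s4] : [/\ has_bsign (sign_pos k Pi21) (curve_fun Pi21 r lam),
      has_bsign (sign_pos k Pi22) (curve_fun Pi22 r lam),
      has_bsign (sign_pos k Pi23) (curve_fun Pi23 r lam) &
      has_bsign (sign_pos k Pi24) (curve_fun Pi24 r lam)].
      have P21 : (lam * (lam - r) ^+ 3 < 1) = (curve_fun Pi21 r lam < 0) by rewrite
        /= subr_lt0.
      have P21' : (1 < lam * (lam - r) ^+ 3) = (0 < curve_fun Pi21 r lam) by rewrite
        /= subr_gt0.
      have P23 : ((lam - r) ^+ 3 * (lam - 3 * r) < 4) = (curve_fun Pi23 r lam < 0)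
        by rewrite /= subr_lt0.
      have P23' : (4 < (lam - r) ^+ 3 * (lam - 3 * r)) = (0 < curve_fun Pi23 r lam)
        by rewrite /= subr_gt0.
      have P22 : (- lam < r) = (0 < curve_fun Pi22 r lam) by rewrite /= -ltrBlDr sub0r.
      have P22' : (r < - lam) = (curve_fun Pi22 r lam < 0) by rewrite /= -ltrBrDr sub0r.
      case: k k2 h {hd c} => //= _;
        rewrite ?P21 ?P21' ?P22 ?P22' ?P23 ?P23' ?L1 ?L2 => -[u v].
      * by have [a1 a2] := o1 u; split=> //; [exact: a1|exact/a2/a1].
      * by have [a1 a2] := o3 u; split=> //; [exact/a2/a1|exact: a1].
      * have u' := o5 v u; have [a1 a2] := o3 u'; split=> //; exact: a2.
      * have u' := o6 u v; have [a1 a2] := o4 u'; split=> //; exact: a2.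
      * have [a1 a2] := o4 u; split=> //; [exact: a1|exact/a2/a1].
      * have u' := o7 u v; have [a1 a2] := o1 u'; split=> //; exact: a2.
      * have u' := o8 u v; have [a1 a2] := o2 u'; split=> //; exact: a2.
      * have [a1 a2] := o2 u; split=> //; [exact/a2/a1|exact: a1].
    by move=> /F2case[] ->.
  + move=> c; case: k hd h k2 => //= hd h k2; (try by case: k2);
      case: c => //= _; by rewrite /has_bsign ?subr_lt0 ?subr_gt0 rE.
- case: k hd h => //= -[h1 h2] h.
  + have := h Pi22 erefl; have := h Pi21 erefl; rewrite /has_bsign /= => ? ?; split;
    lra.
  + have := h Pi22 erefl; have := h Pi24 erefl;
    rewrite /has_bsign (pi24_cmp h1 h2).1 /= => ? ?; split; lra.
  + have := h Pi23 erefl; have := h Pi24 erefl;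
    rewrite /has_bsign (pi24_cmp h1 h2).2 /= => ? ?; split; lra.
  + have := h Pi23 erefl; have := h Pi21 erefl; rewrite /has_bsign /= => ? ?; split;
    lra.
  + have := h Pi22 erefl; have := h Pi21 erefl; rewrite /has_bsign /= => ? ?; split;
    lra.
  + have := h Pi23 erefl; have := h Pi21 erefl; rewrite /has_bsign /= => ? ?; split;
    lra.
  + have := h Pi23 erefl; have := h Pi24 erefl;
    rewrite /has_bsign (pi24_cmp h1 h2).1 /= => ? ?; split; lra.
  + have := h Pi22 erefl; have := h Pi24 erefl;
    rewrite /has_bsign (pi24_cmp h1 h2).2 /= => ? ?; split; lra.
  + by have := h Pi31 erefl; rewrite /has_bsign /= rE; lra.
  + by have := h Pi31 erefl; rewrite /has_bsign /= rE; lra.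
Qed.

Lemma region_cover i r lam : delta_reg i (r, lam) ->
  (forall c, curve_family c = i -> curve_fun c r lam != 0) ->
  exists k, region_family k = i /\ region_set k (r, lam).
Proof.
case: i => hd h.
- by exists D1.
- have h21 := h Pi21 erefl; have h22 := h Pi22 erefl.
  have h23 := h Pi23 erefl; have h24 := h Pi24 erefl.
  have [[ o1 o2 o3 o4] _] := curve_fun_order hd.
  suff [k [k2 [s1 s2 s3 s4]]] : exists k, region_family k = F2 /\
     [/\ has_bsign (sign_pos k Pi21) (curve_fun Pi21 r lam),
      has_bsign (sign_pos k Pi22) (curve_fun Pi22 r lam),
      has_bsign (sign_pos k Pi23) (curve_fun Pi23 r lam) &
      has_bsign (sign_pos k Pi24) (curve_fun Pi24 r lam)].
    exists k; split=> //; apply/region_setE; rewrite k2; split=> //.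
    by case.
  (* Of the sixteen sign patterns eight are regions; the other eight violate the order of the
     curves. *)
  move: h21 h22 h23 h24; rewrite !neq_lt => /orP[] n21 /orP[] n22 /orP[] n23 /orP[] n24.
  + by exists D22.
  + by exists D23.
  + by have := (o4 n22).2 n23; rewrite ltNge (ltW n24).
  + by exists D24.
  + by exists D21.
  + by have := (o2 n22).1 n24; rewrite ltNge (ltW n23).
  + by have := (o2 n22).2 n23; rewrite ltNge (ltW n21).
  + by have := (o2 n22).2 n23; rewrite ltNge (ltW n21).
  + by have := (o4 n22).1 n21; rewrite ltNge (ltW n23).
  + by have := (o4 n22).1 n21; rewrite ltNge (ltW n23).
  + by have := (o4 n22).2 n23; rewrite ltNge (ltW n24).
  + by exists D25.
  + by exists D26.
  + by have := (o2 n22).1 n24; rewrite ltNge (ltW n23).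
  + by exists D27.
  + by exists D28.
- have := h Pi31 erefl; rewrite neq_lt => /orP[n|n].
    by exists D31; split=> //; apply/region_setE; split=> // -[].
  by exists D32; split=> //; apply/region_setE; split=> // -[].
Qed.

End Curves.

(** * Signs of mu_1^2, mu_2^2 and types over the regions *)

Section Types.
Variable R : realType.
Implicit Types (i : equil_family) (k : region) (c : curve) (r lam : R).

(** The other root is X - a > 0, so for t <= 0 the quadratic at t has the sign of a - t. Comparing
    the irrational alpha_1 with a threshold t thus becomes a polynomial condition. *)
Lemma negative_root_sgr (X a t : R) : a < 0 -> a ^+ 2 = X * a + 1 -> t <= 0 ->
  Num.sg (a - t) = Num.sg (t ^+ 2 - X * t - 1).
Proof.
move=> a0 aE t0.
have -> : t ^+ 2 - X * t - 1 = (a - t) * (X - a - t).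
  have -> : 1 = a ^+ 2 - X * a by rewrite aE; ring.
  by ring.
have h : 0 < X - a - t.
  suff : 0 < X - a by lra.
  rewrite -(nmulr_rlt0 _ a0).
  have -> : a * (X - a) = -1 by rewrite mulrBr -expr2 aE; ring.
  lra.
by rewrite sgrM (gtr0_sg h) mulr1.
Qed.

(** Here and in the next two lemmas t is the value of alpha_1 at which mu_1^2, mu_2^2 or z - lam
    vanishes; the quadratic at t is a curve function up to a positive factor. *)
Lemma sgr_mu1sq i r lam : i <> F1 -> delta_reg i (r, lam) ->
  Num.sg (mu1sq i r lam) = - Num.sg (curve_fun Pi23 r lam).
Proof.
move=> i1 hd.
have a0 : al1_of i r lam < 0 by have := al1_of_sign i r lam; case: (i) i1.
have t0 : - ((r - lam) ^+ 2 / 2) <= 0 by rewrite oppr_le0 divr_ge0 // sqr_ge0.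
have := negative_root_sgr a0 (al1_of_sqr i r lam) t0.
rewrite (_ : mu1sq i r lam = - ((al1_of i r lam - - ((r - lam) ^+ 2 / 2)) * 2^-1)).
  rewrite sgrN sgrM (gtr0_sg (_ : 0 < 2^-1)) ?invr_gt0 // mulr1 => ->.
  congr (- _); rewrite [in RHS](_ : curve_fun _ _ _ = 4 *
    ((- ((r - lam) ^+ 2 / 2)) ^+ 2 - r * (r - lam) * (- ((r - lam) ^+ 2 / 2)) - 1)).
    by rewrite sgrM (gtr0_sg (_ : 0 < 4)) // mul1r.
  by rewrite /=; field.
by rewrite mu1sqE; field.
Qed.

Lemma sgr_mu2sq r lam : delta_reg F2 (r, lam) ->
  Num.sg (mu2sq F2 r lam) = - Num.sg (curve_fun Pi24 r lam).
Proof.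
move=> hd; have [r0 l0] := hd; rewrite /fst /snd in r0 l0.
have a0 : al1_of F2 r lam < 0 := al1_of_sign F2 r lam.
have rho0 : r - lam < 0 by lra.
have t0 : r ^+ 2 * (r - lam) / lam <= 0.
  rewrite ler_pdivrMr // mul0r mulr_ge0_le0 ?sqr_ge0 //; exact: ltW.
have := negative_root_sgr a0 (al1_of_sqr F2 r lam) t0.
have c0 : 0 < - (lam / (r - lam)) by rewrite oppr_gt0 pmulr_rlt0 // invr_lt0.
rewrite (_ : mu2sq F2 r lam = - ((al1_of F2 r lam - r ^+ 2 * (r - lam) / lam)
                                * - (lam / (r - lam)))).
  rewrite sgrN sgrM (gtr0_sg c0) mulr1 => ->.
  congr (- _); rewrite [in RHS](_ : curve_fun _ _ _ = lam ^+ 2 *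
    ((r ^+ 2 * (r - lam) / lam) ^+ 2 - r * (r - lam) * (r ^+ 2 * (r - lam) / lam) - 1)).
    by rewrite sgrM (gtr0_sg (_ : 0 < lam ^+ 2)) ?exprn_gt0 // mul1r.
  by rewrite /=; field; exact: lt0r_neq0.
rewrite mu2sqE //; field.
by rewrite (lt0r_neq0 l0) (ltr0_neq0 rho0).
Qed.

Lemma al1_of_Pi21 r lam : delta_reg F2 (r, lam) ->
  (al1_of F2 r lam == lam * (r - lam)) = (curve_fun Pi21 r lam == 0).
Proof.
move=> [r0 l0]; rewrite /fst /snd in r0 l0.
have a0 : al1_of F2 r lam < 0 := al1_of_sign F2 r lam.
have t0 : lam * (r - lam) <= 0 by rewrite mulr_ge0_le0 ?ltW //; lra.
have := negative_root_sgr a0 (al1_of_sqr F2 r lam) t0.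
rewrite -subr_eq0 -sgr_eq0 => ->; rewrite sgr_eq0.
by congr (_ == 0); rewrite /=; ring.
Qed.

Lemma F1_signs r lam : delta_reg F1 (r, lam) ->
  [/\ mu1sq F1 r lam < 0, mu2sq F1 r lam < 0 &
      al1_of F1 r lam != lam * (r - lam)].
Proof.
move=> hd; have [r0 l0] := hd; rewrite /fst /snd in r0 l0.
have a0 : 0 < al1_of F1 r lam := al1_of_sign F1 r lam.
have rho0 : r - lam < 0 by lra.
have lam0 := delta_lam hd.
have lr0 : lam * (r - lam) < 0 by rewrite pmulr_rlt0.
split.
- rewrite mu1sqE; have := sqr_ge0 (r - lam); lra.
- rewrite mu2sqE // ltr_ndivrMr // mul0r.
  have : r ^+ 2 * (r - lam) <= 0 by rewrite mulr_ge0_le0 ?sqr_ge0 // ltW.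
  have : 0 < lam * al1_of F1 r lam by rewrite mulr_gt0.
  lra.
- by rewrite gt_eqF // (lt_trans lr0).
Qed.

Lemma F3_signs r lam : delta_reg F3 (r, lam) ->
  mu2sq F3 r lam < 0 /\ al1_of F3 r lam != lam * (r - lam).
Proof.
move=> hd; have [l0 r0] := hd; rewrite /fst /snd in r0 l0.
have a0 : al1_of F3 r lam < 0 := al1_of_sign F3 r lam.
have rho0 : 0 < r - lam by lra.
have lr0 : 0 < lam * (r - lam) by rewrite mulr_gt0.
split; last by rewrite lt_eqF // (lt_trans a0).
rewrite mu2sqE // ltr_pdivrMr // mul0r.
have : 0 <= r ^+ 2 * (r - lam) by rewrite mulr_ge0 ?sqr_ge0 // ltW.
have : lam * al1_of F3 r lam < 0 by rewrite pmulr_rlt0.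
lra.
Qed.

Lemma sgr_neq0 (u v : R) : Num.sg u = - Num.sg v -> (u != 0) = (v != 0).
Proof. by move=> h; rewrite -sgr_eq0 h oppr_eq0 sgr_eq0. Qed.

Lemma xi_nondegenerate_curves i s r lam : delta_reg i (r, lam) ->
  is_nondegenerate (xi_ext i s r lam) <->
  forall c, curve_family c = i -> curve_fun c r lam != 0.
Proof.
move=> hd; rewrite xi_nondegenerate //; case: i hd => hd.
- have [m1 m2 a] := F1_signs hd; split=> [_ []//|_]; split=> //;
    try exact: ltr0_neq0.
  by apply: lt0r_neq0; have := delta_lam hd; have [] := hd => /=; lra.
- rewrite (sgr_neq0 (sgr_mu1sq _ hd)) // (sgr_neq0 (sgr_mu2sq hd)) al1_of_Pi21 //.
  split=> [[h1 h2 h3 h4] [] //|h].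
  by split; [exact: (h Pi23)|exact: (h Pi24)|exact: (h Pi22)|exact: (h Pi21)].
- have [m2 a] := F3_signs hd; rewrite (sgr_neq0 (sgr_mu1sq _ hd)) //.
  split=> [[h _ _ _] [] //|h]; split=> //; first exact: (h Pi31).
    exact: ltr0_neq0.
  by apply: lt0r_neq0; have [] := hd => /=; lra.
Qed.

Lemma xi_cond_indep_curve i s r lam : delta_reg i (r, lam) ->
  ~ cond_indep (xi_ext i s r lam) <-> i = F2 /\ curve_fun Pi21 r lam = 0.
Proof.
move=> hd; rewrite xi_cond_indep //; case: i hd => hd.
- by have [_ _ ->] := F1_signs hd; split=> // -[].
- rewrite al1_of_Pi21 //; split=> [/negP/negPn/eqP //|[_ ->]].
  by rewrite eqxx.
- by have [_ ->] := F3_signs hd; split=> // -[].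
Qed.

Lemma region_signs k r lam : region_set k (r, lam) ->
  has_sign (region_type k).1 (mu1sq (region_family k) r lam) /\
  has_sign (region_type k).2 (mu2sq (region_family k) r lam).
Proof.
move=> /region_setE[hd h].
have hs b (u v : R) : Num.sg u = - Num.sg v -> has_bsign b v ->
    has_sign (if b then Center else Saddle) u.
  move=> e; case: b => /=; rewrite /has_bsign /has_sign => v0.
    by rewrite -sgr_lt0 e oppr_lt0 sgr_gt0.
  by rewrite -sgr_gt0 e oppr_gt0 sgr_lt0.
have [k1|k1] : region_family k = F1 \/ region_family k <> F1.
  by case: (k); by [left | right].
  by case: k k1 hd {h} => //= _ /F1_signs[].
have h1 := hs _ _ _ (sgr_mu1sq k1 hd).
have h2 (e : region_family k = F2) := hs _ _ _ (sgr_mu2sq (eq_ind _ (fun i =>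
  delta_reg i (r, lam)) hd _ e)).
by case: k k1 h1 h2 hd h => //= _ h1 h2 hd h; split;
  first [ exact: (h1 _ (h Pi23 erefl)) | exact: (h1 _ (h Pi31 erefl))
        | exact: (h2 _ _ (h Pi24 erefl)) | exact: (F3_signs hd).1 ].
Qed.

Lemma region_delta k r lam : region_set k (r, lam) -> delta_reg (region_family k) (r,
  lam).
Proof. by case. Qed.

Lemma xi_has_type k s r lam : region_set k (r, lam) ->
  has_type (xi_ext (region_family k) s r lam) (region_type k).
Proof.
move=> hk; have hd := region_delta hk; have [h1 h2] := region_signs hk.
have n0 t (u : R) : has_sign t u -> u != 0.
  by case: t => /= h; [exact: ltr0_neq0|exact: lt0r_neq0].
exists (region_family k), s, r, lam; split=> //.
  by rewrite /= xi_det // mulf_neq0 //; [exact: n0 h1|exact: n0 h2].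
have [m1 [m2 [e1 e2 e3]]] := xi_eigenvalues hd s.
exists m1, m2; split=> //; rewrite /pair_kind ?e2 ?e3.
  by case: (region_type k).1 h1 => /=; rewrite -(rmorph0 (real_complex R)) ltcR.
by case: (region_type k).2 h2 => /=; rewrite -(rmorph0 (real_complex R)) ltcR.
Qed.

Lemma over_region_nondegenerate k (p : ext R) : over_region k p -> nondeg_equilibria p.
Proof.
move=> [s [r [lam [hk ->]]]]; have hd := region_delta hk.
split; first by split; [exact: delta_lam hd|exact: xi_rel_equilibrium].
apply/xi_nondegenerate_curves => // c e.
have /region_setE[_ /(_ c e)] := hk.
by case: sign_pos => h; [exact: lt0r_neq0|exact: ltr0_neq0].
Qed.

Lemma nondegenerate_over (p : ext R) : nondeg_equilibria p -> exists k, over_region k p.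
Proof.
case: p => x lam [[/= l0]]; rewrite rel_equilibriaE // => hx hn.
have [i [s [r [hd e]]]] : exists i s r, delta_reg i (r, lam) /\ x = xi i s r lam.
  by case: hx => [[|]|] [s [r h]]; [exists F1|exists F2|exists F3]; exists s, r.
subst x.
have /region_cover[//|k [ek hk]] := (xi_nondegenerate_curves s hd).1 hn.
by exists k, s, r, lam; split=> //; rewrite ek.
Qed.

Lemma sign_pos_inj k k' : region_family k = region_family k' ->
  (forall c, curve_family c = region_family k -> sign_pos k c = sign_pos k' c) ->
  k = k'.
Proof.
by case: k; case: k' => //= _ h;
  first [ have := h Pi21 erefl; discriminate | have := h Pi22 erefl; discriminate
        | have := h Pi23 erefl; discriminate | have := h Pi24 erefl; discriminate
        | have := h Pi31 erefl; discriminate ].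
Qed.

(* The signs of [alpha_1] and of [omega_3 - lam] tell the families apart. *)
Definition family_sign i (a rho : R) : Prop :=
  match i with F1 => 0 < a | F2 => a < 0 /\ rho < 0 | F3 => a < 0 /\ 0 < rho end.

Lemma xi_family_sign i s r lam : delta_reg i (r, lam) ->
  family_sign i (al1 (xi i s r lam)) (om3 (xi i s r lam) - lam).
Proof.
move=> hd; rewrite /xi !mkphaseE -/(al1_of i r lam).
by have := al1_of_sign i r lam; case: i hd => /= -[] *; try split; lra.
Qed.

Lemma family_sign_inj i i' (a rho : R) : family_sign i a rho -> family_sign i' a rho
  -> i = i'.
Proof. by case: i; case: i' => //= h h'; exfalso; lra. Qed.

(** The sheets [s] and [s'] cannot be compared: xi_+ and xi_- coincide at r = 0. *)
Lemma xi_ext_inj i s r lam i' s' r' lam' :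
  delta_reg i (r, lam) -> delta_reg i' (r', lam') ->
  xi_ext i s r lam = xi_ext i' s' r' lam' -> [/\ i = i', r = r' & lam = lam'].
Proof.
move=> hd hd' e; have el : lam = lam' by case: e.
have ex : xi i s r lam = xi i' s' r' lam' by case: e.
split=> //; last by have := congr1 (@om3 R) ex; rewrite !mkphaseE.
have := xi_family_sign s hd; rewrite ex el => h.
exact: family_sign_inj h (xi_family_sign s' hd').
Qed.

Lemma over_region_uniq k k' (p : ext R) : over_region k p -> over_region k' p -> k = k'.
Proof.
move=> [s [r [lam [hk ->]]]] [s' [r' [lam' [hk' e]]]].
have [ei er el] := xi_ext_inj (region_delta hk) (region_delta hk') e; subst r' lam'.
apply: sign_pos_inj => // c ec.
have /region_setE[_ /(_ c ec)] := hk.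
have /region_setE[_ /(_ c)] := hk'; rewrite -ei => /(_ ec).
by case: sign_pos; case: sign_pos => //=; rewrite /has_bsign; lra.
Qed.

End Types.

(** * Paths inside a region *)

Section Paths.
Variable R : realType.
Implicit Types (i : equil_family) (k : region) (c : curve) (r lam m t : R).

Lemma cvg_mkphase (T : Type) (F : set_system T) (FF : Filter F)
    (f1 f2 f3 f4 f5 f6 : T -> R) (l1 l2 l3 l4 l5 l6 : R) :
  f1 @ F --> l1 -> f2 @ F --> l2 -> f3 @ F --> l3 ->
  f4 @ F --> l4 -> f5 @ F --> l5 -> f6 @ F --> l6 ->
  (fun u => mkphase (f1 u) (f2 u) (f3 u) (f4 u) (f5 u) (f6 u)) @ F -->
    mkphase l1 l2 l3 l4 l5 l6.
Proof.
have E (a b c d e f : R) : mkphase a b c d e f =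
    a *: mkphase 1 0 0 0 0 0 + b *: mkphase 0 1 0 0 0 0 + c *: mkphase 0 0 1 0 0 0
    + d *: mkphase 0 0 0 1 0 0 + e *: mkphase 0 0 0 0 1 0 + f *: mkphase 0 0 0 0 0 1.
  by rewrite !mkphaseZ !mkphaseD; congr mkphase; ring.
move=> h1 h2 h3 h4 h5 h6; rewrite (E l1 l2 l3 l4 l5 l6).
rewrite (funext (fun u => E (f1 u) (f2 u) (f3 u) (f4 u) (f5 u) (f6 u))).
apply: cvgD; last exact: cvgZr_tmp h6.
apply: cvgD; last exact: cvgZr_tmp h5.
apply: cvgD; last exact: cvgZr_tmp h4.
apply: cvgD; last exact: cvgZr_tmp h3.
by apply: cvgD; [exact: cvgZr_tmp h1|exact: cvgZr_tmp h2].
Qed.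

Lemma cvg_d_of i (T : Type) (F : set_system T) (FF : Filter F) (f g : T -> R) r lam :
  f @ F --> r -> g @ F --> lam -> (fun u => d_of i (f u) (g u)) @ F --> d_of i r lam.
Proof.
move=> hf hg.
have h : (fun u => Num.sqrt (f u ^+ 2 * (f u - g u) ^+ 2 + 4)) @ F -->
    Num.sqrt (r ^+ 2 * (r - lam) ^+ 2 + 4).
  apply: continuous_cvg; first exact: sqrt_continuous.
  apply: cvgD; last exact: cvg_cst.
  have hfg : (fun u => f u - g u) @ F --> r - lam by exact: cvgB.
  by apply: cvgM; rewrite expr2; apply: cvgM.
by case: i => //; exact: cvgN.
Qed.

Lemma cvg_xi_ext i s (T : Type) (F : set_system T) (FF : Filter F) (f g : T -> R) r
  lam :
  r - lam != 0 -> f @ F --> r -> g @ F --> lam ->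
  (fun u => xi_ext i s (f u) (g u)) @ F --> xi_ext i s r lam.
Proof.
move=> rl hf hg.
suff h : (fun u => xi i s (f u) (g u)) @ F --> xi i s r lam.
  exact: (@cvg_pair _ _ _ F (nbhs (xi i s r lam)) (nbhs lam) _ _ _ _ _ h hg).
have hd := cvg_d_of (i := i) FF hf hg.
have hfg : (fun u => f u - g u) @ F --> r - lam by exact: cvgB.
have hV : (fun u => (-1) ^+ s * V_of i (f u) (g u)) @ F --> (-1) ^+ s * V_of i r lam.
  apply: cvgM; first exact: cvg_cst.
  apply: continuous_cvg; first exact: sqrt_continuous.
  apply: cvgM; first by apply: cvgM => //; exact: cvg_cst.
  apply: cvgD; first exact: cvgN.
  by apply: cvgM => //; exact: cvgV.
apply: cvg_mkphase => //; try exact: cvg_cst.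
  apply: cvgM; last exact: cvg_cst.
  by apply: cvgB => //; apply: cvgM.
by apply: cvgM => //; exact: cvgN.
Qed.

(* In the coordinates [m = lam / (lam - r)] and [t = (lam - r) ^- 4] the curves
   are the graphs [t = m], [t = (3 - 2 m) / 4] and [t = (1 - m) ^+ 3 / m ^+ 2]
   and the line [m = 1 / 2], and every region lies over an interval of the
   [m]-axis, between the graphs of [reg_lo] and [reg_hi]. *)
Definition reg_itv k : interval R :=
  match k with
  | D1 => `[1, +oo[
  | D21 | D26 | D27 => `]2^-1, 1]
  | D28 => `]2^-1, 1[
  | D31 | D32 => `]-oo, 0[
  | _ => `]0, 2^-1[
  end.

Definition reg_lo k m : R :=
  match k with
  | D1 | D25 | D28 | D32 => 0
  | D21 | D24 => m
  | D22 | D27 => (1 - m) ^+ 3 * (m^-1 * m^-1)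
  | _ => (3 - 2 * m) / 4
  end.

Definition reg_bounded k : bool :=
  match k with D1 | D21 | D22 | D31 => false | _ => true end.

(** The thickness of the strip, upper graph minus lower graph. For a strip unbounded above, the
    upper graph is a dummy that makes the thickness 1, so that dividing by it changes nothing. *)
Definition reg_gap k m : R :=
  match k with
  | D25 | D26 => m
  | D24 | D27 | D32 => (3 - 2 * m) / 4
  | D23 | D28 => (1 - m) ^+ 3 * (m^-1 * m^-1)
  | _ => reg_lo k m + 1
  end - reg_lo k m.

Definition reg_height k : interval R := if reg_bounded k then `]0, 1[ else `]0, +oo[.

Lemma reg_itv_neq0 k m : m \in reg_itv k -> m != 0.
Proof. by case: k; rewrite /= !in_itv /=; lra. Qed.

Lemma reg_lo_ge0 k m : m \in reg_itv k -> 0 <= reg_lo k m.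
Proof.
have g0 : 0 <= 1 - m -> 0 <= (1 - m) ^+ 3 * (m^-1 * m^-1).
  by move=> h; rewrite -expr2 mulr_ge0 ?sqr_ge0 // exprn_ge0.
by case: k; rewrite /= ?in_itv /=; try lra; move=> h; apply: g0; lra.
Qed.

(** The two graphs cross at m = 1/2 and touch at m = 2, so on 0 < m <= 1 their order changes only at
    m = 1/2. *)
Lemma graph_difference m : m != 0 ->
  (1 - m) ^+ 3 * (m^-1 * m^-1) - (3 - 2 * m) / 4 =
  (1 - 2 * m) * ((m - 2) / (2 * m)) ^+ 2.
Proof. by move=> m0; field. Qed.

Lemma reg_gap_gt0 k m : m \in reg_itv k -> 0 < reg_gap k m.
Proof.
move=> hm; have m0 := reg_itv_neq0 hm.
have h := graph_difference m0.
have q0 : m < 2 -> 0 < ((m - 2) / (2 * m)) ^+ 2.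
  by move=> m2; rewrite exprn_even_gt0 //= mulf_neq0 ?invr_eq0 ?mulf_neq0 //; lra.
case: k hm => /=; rewrite in_itv /= /reg_gap /= => hm; try lra.
- by rewrite h mulr_gt0 ?q0 //; lra.
- by rewrite -opprB h -mulNr mulr_gt0 ?q0 //; lra.
- by rewrite subr0 -expr2 mulr_gt0 ?exprn_gt0 ?invr_gt0 //; lra.
Qed.

Lemma cvg_graph (T : Type) (F : set_system T) (FF : Filter F) (f : T -> R) m :
  m != 0 -> f @ F --> m ->
  (fun u => (1 - f u) ^+ 3 * ((f u)^-1 * (f u)^-1)) @ F --> (1 - m) ^+ 3 * (m^-1 *
    m^-1).
Proof.
move=> m0 hf; have hV : (fun u => (f u)^-1) @ F --> m^-1 by exact: cvgV.
apply: cvgM; last exact: cvgM.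
have h1 : (fun u => 1 - f u) @ F --> 1 - m by apply: cvgB => //; exact: cvg_cst.
by rewrite 2!exprS; do 2![apply: cvgM => //].
Qed.

Lemma cvg_line (T : Type) (F : set_system T) (FF : Filter F) (f : T -> R) m :
  f @ F --> m -> (fun u => (3 - 2 * f u) / 4) @ F --> (3 - 2 * m) / 4.
Proof.
move=> hf; apply: cvgM; last exact: cvg_cst.
by apply: cvgB; [exact: cvg_cst|apply: cvgM => //; exact: cvg_cst].
Qed.

Lemma cvg_reg_lo k (T : Type) (F : set_system T) (FF : Filter F) (f : T -> R) m :
  m != 0 -> f @ F --> m -> (fun u => reg_lo k (f u)) @ F --> reg_lo k m.
Proof.
move=> m0 hf; have hg := cvg_graph FF m0 hf; have hs := cvg_line FF hf.
case: k; first [exact: hf | exact: hg | exact: hs | exact: cvg_cst].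
Qed.

Lemma cvg_reg_gap k (T : Type) (F : set_system T) (FF : Filter F) (f : T -> R) m :
  m != 0 -> f @ F --> m -> (fun u => reg_gap k (f u)) @ F --> reg_gap k m.
Proof.
move=> m0 hf; apply: cvgB; last exact: cvg_reg_lo.
have hl1 k' : (fun u => reg_lo k' (f u) + 1) @ F --> reg_lo k' m + 1.
  by apply: cvgD; [exact: (cvg_reg_lo FF m0 hf)|exact: cvg_cst].
have hg := cvg_graph FF m0 hf; have hs := cvg_line FF hf.
case: k.
- exact: (hl1 D1).
- exact: (hl1 D21).
- exact: (hl1 D22).
- exact: hg.
- exact: hs.
- exact: hf.
- exact: hf.
- exact: hs.
- exact: hg.
- exact: (hl1 D31).
- exact: hs.
Qed.

Definition fam_sgn i : R := match i with F3 => -1 | _ => 1 end.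

(** Recovers y = lam - r from t = y^-4; the sign of y is fixed by the family. *)
Definition y_of i t : R := fam_sgn i * (Num.sqrt (Num.sqrt t))^-1.

Lemma y_of_pow4 i t : 0 < t -> y_of i t ^+ 4 = t^-1.
Proof.
move=> t0;
  rewrite /y_of exprMn exprVn (exprM (Num.sqrt (Num.sqrt t)) 2 2) sqr_sqrtr
    ?sqrtr_ge0 //.
rewrite sqr_sqrtr ?ltW // (_ : fam_sgn i ^+ 4 = 1) ?mul1r //.
by case: i; rewrite /= ?expr1n //; ring.
Qed.

Lemma y_of_sign i t : 0 < t -> 0 < fam_sgn i * y_of i t.
Proof.
move=> t0; rewrite /y_of mulrA (_ : fam_sgn i * fam_sgn i = 1) ?mul1r.
  by rewrite invr_gt0 !sqrtr_gt0.
by case: i => /=; ring.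
Qed.

Lemma y_of_uniq i (y : R) : 0 < fam_sgn i * y -> y_of i (y ^+ 4)^-1 = y.
Proof.
move=> y0.
have y2 : Num.sqrt (y ^+ 4)^-1 = (y ^+ 2)^-1.
  by rewrite -exprVn (exprM _ 2 2) sqrtr_sqr ger0_norm ?sqr_ge0 // exprVn.
rewrite /y_of y2 -exprVn sqrtr_sqr normrV ?unitfE; last by case: i y0 => /=; lra.
rewrite invrK; case: i y0 => /= y0.
- by rewrite gtr0_norm; lra.
- by rewrite gtr0_norm; lra.
- by rewrite ltr0_norm; lra.
Qed.

End Paths.

(** * Regions in the coordinates m and t *)

Section RegionCoordinates.
Variable R : realType.
Implicit Types (i : equil_family) (k : region) (c : curve) (r lam m t : R).

Lemma reg_heightE k m t : m \in reg_itv R k ->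
  ((t - reg_lo k m) / reg_gap k m \in reg_height R k) =
  (reg_lo k m < t) && (reg_bounded k ==> (t < reg_gap k m + reg_lo k m)).
Proof.
move=> hm; have g0 := reg_gap_gt0 hm; rewrite /reg_height.
have gi0 : 0 < (reg_gap k m)^-1 by rewrite invr_gt0.
by case: reg_bounded; rewrite in_itv /= ?andbT pmulr_lgt0 // subr_gt0
  ?ltr_pdivrMr // ?mul1r ?ltrBlDr.
Qed.

Section Coordinates.
Variables (r lam y m : R).
Hypotheses (rE : r = (m - 1) * y) (lE : lam = m * y) (y0 : y != 0).
Let t := (y ^+ 4)^-1.

Let y4 : 0 < y ^+ 4.
Proof. by rewrite exprn_even_gt0. Qed.

Let t0 : 0 < t.
Proof. by rewrite invr_gt0. Qed.

(** Each curve function is homogeneous, or a difference of two homogeneous terms whose degrees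
    differ by 4. Pulling out a power of y therefore leaves the vertical distance from (m, t) to a
    graph, or for [Pi22] the distance to a vertical line. *)
Lemma sgr_c21 : Num.sg (curve_fun Pi21 r lam) = Num.sg (m - t).
Proof.
rewrite (_ : curve_fun _ _ _ = y ^+ 4 * (m - t)); first by rewrite sgrM gtr0_sg ?mul1r.
by rewrite /= rE lE /t; field.
Qed.

Lemma sgr_c23 : Num.sg (curve_fun Pi23 r lam) = Num.sg ((3 - 2 * m) / 4 - t).
Proof.
rewrite (_ : curve_fun _ _ _ = 4 * y ^+ 4 * ((3 - 2 * m) / 4 - t)).
  by rewrite sgrM gtr0_sg ?mul1r // mulr_gt0.
by rewrite /= rE lE /t; field.
Qed.

Lemma sgr_c24 : m != 0 ->
  Num.sg (curve_fun Pi24 r lam) = Num.sg ((1 - m) ^+ 3 * (m^-1 * m^-1) - t).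
Proof.
move=> m0.
rewrite (_ : curve_fun _ _ _ =
  m ^+ 2 * y ^+ 2 * y ^+ 4 * ((1 - m) ^+ 3 * (m^-1 * m^-1) - t)).
  rewrite sgrM gtr0_sg ?mul1r //.
  by apply: mulr_gt0 => //; apply: mulr_gt0; rewrite exprn_even_gt0.
by rewrite /= rE lE /t; field; rewrite m0 y0.
Qed.

Lemma sgr_c22 : 0 < y -> Num.sg (curve_fun Pi22 r lam) = Num.sg (m - 2^-1).
Proof.
move=> yp; rewrite (_ : curve_fun _ _ _ = 2 * y * (m - 2^-1)).
  by rewrite sgrM gtr0_sg ?mul1r // mulr_gt0.
by rewrite /= rE lE; field.
Qed.

Lemma delta_coordE i : 0 < fam_sgn R i * y ->
  delta_reg i (r, lam) <->
  match i with F1 => 1 <= m | F2 => 0 < m <= 1 | F3 => m < 0 end.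
Proof.
case: i => /=; rewrite ?mul1r ?mulN1r ?oppr_gt0 => yp; rewrite rE lE.
- rewrite pmulr_lge0 // subr_ge0; split=> [[]//|h]; split=> //; lra.
- rewrite pmulr_lle0 // subr_le0 pmulr_lgt0 //.
  by split=> [[-> ->]//|/andP[]].
- rewrite nmulr_lgt0 //; split=> [[]//|h]; split=> //; lra.
Qed.

Lemma region_coordE k : 0 < fam_sgn R (region_family k) * y ->
  region_set k (r, lam) <->
  m \in reg_itv R k /\ (t - reg_lo k m) / reg_gap k m \in reg_height R k.
Proof.
move=> hy; have hdE := delta_coordE hy.
have S (u v : R) : Num.sg u = Num.sg v ->
    (0 < u) = (0 < v) /\ (u < 0) = (v < 0).
  by move=> e; rewrite -sgr_gt0 e sgr_gt0 -[u < 0]sgr_lt0 e sgr_lt0.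
have [p21 n21] := S _ _ sgr_c21; have [p23 n23] := S _ _ sgr_c23.
have bE b (u v : R) : Num.sg u = Num.sg v -> has_bsign b u <-> has_bsign b v.
  by move=> /S[e1 e2]; case: b; rewrite /has_bsign ?e1 ?e2.
split.
  move=> /region_setE[/hdE hd h].
  have m0 : m != 0 by case: region_family hd; lra.
  suff [hm h1 h2] : [/\ m \in reg_itv R k, reg_lo k m < t &
      reg_bounded k -> t < reg_gap k m + reg_lo k m].
    by split=> //; rewrite reg_heightE // h1 /=; apply/implyP.
  rewrite /reg_gap subrK.
  have f21 (e : F2 = region_family k) := (bE _ _ _ sgr_c21).1 (h Pi21 e).
  have f22 (e : F2 = region_family k) (yp : 0 < y) := (bE _ _ _ (sgr_c22 yp)).1 (h
    Pi22 e).
  have f23 (e : F2 = region_family k) := (bE _ _ _ sgr_c23).1 (h Pi23 e).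
  have f24 (e : F2 = region_family k) := (bE _ _ _ (sgr_c24 m0)).1 (h Pi24 e).
  have f31 (e : F3 = region_family k) := (bE _ _ _ sgr_c23).1 (h Pi31 e).
  case: k hy hdE hd h f21 f22 f23 f24 f31 => hy hdE hd h f21 f22 f23 f24 f31;
    rewrite /= ?mul1r in hy hd; rewrite in_itv /=.
  - by split=> //; rewrite ?hd //; exact: t0.
  - have := f21 erefl; have := f22 erefl hy; have := f23 erefl; have := f24 erefl.
    (* With the value of the nonlinear graph abstracted to g, the goals are linear in m, t and g. *)
    rewrite /has_bsign /=; move: (_ ^+ 3 * _) => g; split=> //; lra.
  - have := f21 erefl; have := f22 erefl hy; have := f23 erefl; have := f24 erefl.
    rewrite /has_bsign /=; move: (_ ^+ 3 * _) => g; split=> //; lra.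
  - have := f21 erefl; have := f22 erefl hy; have := f23 erefl; have := f24 erefl.
    rewrite /has_bsign /=; move: (_ ^+ 3 * _) => g; split=> //; lra.
  - have := f21 erefl; have := f22 erefl hy; have := f23 erefl; have := f24 erefl.
    rewrite /has_bsign /=; move: (_ ^+ 3 * _) => g; split=> //; lra.
  - have := f21 erefl; have := f22 erefl hy; have := f23 erefl; have := f24 erefl.
    rewrite /has_bsign /=; move: (_ ^+ 3 * _) => g; split=> //; have := t0; lra.
  - have := f21 erefl; have := f22 erefl hy; have := f23 erefl; have := f24 erefl.
    rewrite /has_bsign /=; move: (_ ^+ 3 * _) => g; split=> //; lra.
  - have := f21 erefl; have := f22 erefl hy; have := f23 erefl; have := f24 erefl.
    rewrite /has_bsign /=; move: (_ ^+ 3 * _) => g; split=> //; lra.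
  - have := f21 erefl; have := f22 erefl hy; have := f23 erefl; have := f24 erefl.
    rewrite /has_bsign /=; have := graph_difference m0; rewrite /reg_lo.
    (* At m = 1 the upper graph reaches 0 and leaves no room for t > 0, which is why this interval
       is open at 1. *)
    have [m1|m1] := eqVneq m 1; first by rewrite m1 subrr expr0n /= mul0r; have := t0;
      lra.
    move: (_ ^+ 3 * _) => g _; split=> //; have := t0; lra.
  - by have := f31 erefl; rewrite /has_bsign /=; split=> //; lra.
  - by have := f31 erefl; rewrite /has_bsign /=; split=> //; have := t0; lra.
move=> [hm]; rewrite reg_heightE // /reg_gap subrK => /andP[h1 /implyP h2].
have m0 := reg_itv_neq0 hm.
have [p24 n24] := S _ _ (sgr_c24 m0).
have hd : delta_reg (region_family k) (r, lam).
  by apply/hdE; case: (k) hm; rewrite /= in_itv /=; lra.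
split=> //.
case: k hy hdE hm hd h1 h2 => hy hdE hm hd h1 h2 //; rewrite in_itv /= in hm;
  rewrite /= ?mul1r in hy h1 h2.
- have [p22 n22] := S _ _ (sgr_c22 hy).
  have : 0 < curve_fun Pi22 r lam by rewrite p22; lra.
  have : curve_fun Pi21 r lam < 0 by rewrite n21; lra.
  by rewrite /= => ? ?; split; lra.
- have [p22 n22] := S _ _ (sgr_c22 hy).
  have : curve_fun Pi22 r lam < 0 by rewrite n22; lra.
  have : curve_fun Pi24 r lam < 0 by rewrite n24; lra.
  rewrite -(pi24_cmp hd.1 hd.2).1 /= => ? ?; split=> //; lra.
- have : curve_fun Pi23 r lam < 0 by rewrite n23; lra.
  have : 0 < curve_fun Pi24 r lam by rewrite p24 subr_gt0; exact: h2.
  rewrite -(pi24_cmp hd.1 hd.2).2 /= => ? ?; split=> //; lra.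
- have : 0 < curve_fun Pi23 r lam by rewrite p23 subr_gt0; exact: h2.
  have : curve_fun Pi21 r lam < 0 by rewrite n21; lra.
  by rewrite /= => ? ?; split; lra.
- have [p22 n22] := S _ _ (sgr_c22 hy).
  have : curve_fun Pi22 r lam < 0 by rewrite n22; lra.
  have : 0 < curve_fun Pi21 r lam by rewrite p21 subr_gt0; exact: h2.
  by rewrite /= => ? ?; split; lra.
- have : curve_fun Pi23 r lam < 0 by rewrite n23; lra.
  have : 0 < curve_fun Pi21 r lam by rewrite p21 subr_gt0; exact: h2.
  by rewrite /= => ? ?; split; lra.
- have : 0 < curve_fun Pi23 r lam by rewrite p23 subr_gt0; exact: h2.
  have : curve_fun Pi24 r lam < 0 by rewrite n24 subr_lt0.
  rewrite -(pi24_cmp hd.1 hd.2).1 /= => ? ?; split=> //; lra.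
- have [p22 n22] := S _ _ (sgr_c22 hy).
  have : 0 < curve_fun Pi22 r lam by rewrite p22; lra.
  have : 0 < curve_fun Pi24 r lam by rewrite p24 subr_gt0; exact: h2.
  rewrite -(pi24_cmp hd.1 hd.2).2 /= => ? ?; split=> //; lra.
- have : curve_fun Pi23 r lam < 0 by rewrite n23; lra.
  rewrite /= => ?; rewrite (_ : _ * _ = (lam - r) ^+ 3 * (lam - 3 * r)); [lra|ring].
- have : 0 < curve_fun Pi23 r lam by rewrite p23 subr_gt0; exact: h2.
  rewrite /= => ?; rewrite (_ : _ * _ = (lam - r) ^+ 3 * (lam - 3 * r)); [lra|ring].
Qed.

End Coordinates.
End RegionCoordinates.

(** * Path connectedness of the regions and of the sheets over them *)

Section RegionPaths.
Variable R : realType.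
Implicit Types (i : equil_family) (k : region) (c : curve) (r lam m t : R).

Lemma itv_convex (I : interval R) (a b u : R) : a \in I -> b \in I -> u \in `[0, 1] ->
  a + u * (b - a) \in I.
Proof.
move=> aI bI; rewrite in_itv /= => /andP[u0 u1].
have [ab|ba] := lerP a b.
  apply: (@interval_is_interval R I a b) => //; apply/andP; split.
    by rewrite lerDl mulr_ge0 // subr_ge0.
  by rewrite -lerBrDl ler_piMl // subr_ge0.
apply: (@interval_is_interval R I b a) => //; apply/andP; split.
  have : (1 - u) * (b - a) <= 0 by rewrite mulr_ge0_le0 //; lra.
  by rewrite mulrBl mul1r; lra.
by rewrite gerDl mulr_ge0_le0 //; lra.
Qed.

Lemma cvg_affine (a b u : R) : (fun v => a + v * (b - a)) @ u --> a + u * (b - a).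
Proof.
apply: cvgD; first exact: cvg_cst.
by apply: cvgM; [exact: cvg_id|exact: cvg_cst].
Qed.

Lemma delta_y i r lam : delta_reg i (r, lam) -> 0 < fam_sgn R i * (lam - r).
Proof. by case: i => /= -[] *; lra. Qed.

Lemma fam_sgn_neq0 i (y : R) : 0 < fam_sgn R i * y -> y != 0.
Proof. by case: i => /=; lra. Qed.

Lemma region_coord k r lam (m := lam / (lam - r)) (t := ((lam - r) ^+ 4)^-1) :
  region_set k (r, lam) ->
  m \in reg_itv R k /\ (t - reg_lo k m) / reg_gap k m \in reg_height R k.
Proof.
move=> hk; have y0 := delta_y (region_delta hk); have n0 := fam_sgn_neq0 y0.
have lE : lam = m * (lam - r) by rewrite divfK.
have rE : r = (m - 1) * (lam - r) by rewrite mulrBl -lE mul1r; ring.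
exact: (region_coordE rE lE n0 y0).1 hk.
Qed.

Definition coord_t k m (s : R) : R := s * reg_gap k m + reg_lo k m.
Definition coord_y k m (s : R) : R := y_of (region_family k) (coord_t k m s).

Lemma coord_region k m s : m \in reg_itv R k -> s \in reg_height R k ->
  region_set k ((m - 1) * coord_y k m s, m * coord_y k m s).
Proof.
move=> hm hs; have g0 := reg_gap_gt0 hm.
have s0 : 0 < s by move: hs; rewrite /reg_height; case: ifP; rewrite in_itv /=; lra.
have t0 : 0 < coord_t k m s by rewrite ltr_wpDr ?reg_lo_ge0 // mulr_gt0.
have y0 := y_of_sign (region_family k) t0.
apply/(region_coordE erefl erefl (fam_sgn_neq0 y0) y0).
by rewrite y_of_pow4 // invrK /coord_t addrK mulfK ?lt0r_neq0.
Qed.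

Lemma region_nonempty k : exists r lam, region_set k (r, lam).
Proof.
suff [m hm] : exists m, m \in reg_itv R k.
  have hs : 2^-1 \in reg_height R k.
    by rewrite /reg_height; case: reg_bounded; rewrite in_itv /= ?andbT; lra.
  by exists ((m - 1) * coord_y k m 2^-1), (m * coord_y k m 2^-1); exact: coord_region.
pose m0 : R := match k with
  | D1 => 1 | D21 | D26 | D27 | D28 => 3 / 4 | D31 | D32 => -1 | _ => 4^-1 end.
by exists m0; rewrite /m0; case: k {m0}; rewrite in_itv /= ?andbT; do ?[apply/andP;
  split]; lra.
Qed.

(** Replacing t by its relative height s = (t - [reg_lo]) / [reg_gap] straightens the strip: in (m,
    s) a region is a product of two intervals, and the affine segment is carried back. *)
Lemma region_path k r lam r' lam' :
  region_set k (r, lam) -> region_set k (r', lam') ->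
  exists f g : R -> R, [/\ f 0 = r /\ g 0 = lam, f 1 = r' /\ g 1 = lam' &
    forall u, u \in `[0, 1] ->
      [/\ region_set k (f u, g u), f @ u --> f u & g @ u --> g u]].
Proof.
move=> hk hk'; have [hm hs] := region_coord hk; have [hm' hs'] := region_coord hk'.
set m := lam / _ in hm hs; set s := _ / _ in hs.
set m' := lam' / _ in hm' hs'; set s' := _ / _ in hs'.
pose M u := m + u * (m' - m); pose S u := s + u * (s' - s).
pose Y u := coord_y k (M u) (S u).
have Yend r0 lam0 (hk0 : region_set k (r0, lam0)) :
    coord_y k (lam0 / (lam0 - r0))
      ((((lam0 - r0) ^+ 4)^-1 - reg_lo k (lam0 / (lam0 - r0)))
         / reg_gap k (lam0 / (lam0 - r0))) = lam0 - r0 /\ lam0 - r0 != 0.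
  have [h _] := region_coord hk0; have g0 := reg_gap_gt0 h.
  have y0 := delta_y (region_delta hk0).
  rewrite /coord_y /coord_t divfK; last exact: lt0r_neq0.
  rewrite subrK y_of_uniq //.
  by split=> //; exact: fam_sgn_neq0 y0.
exists (fun u => (M u - 1) * Y u), (fun u => M u * Y u); split.
- have [e n0] := Yend _ _ hk.
  rewrite /Y /M /S !mul0r !addr0 e mulrBl divfK // mul1r; split=> //; ring.
- have [e n0] := Yend _ _ hk'.
  rewrite /Y /M /S !mul1r !subrKC e mulrBl divfK // mul1r; split=> //; ring.
move=> u hu; have hM : M u \in reg_itv R k by exact: itv_convex.
have hS : S u \in reg_height R k by exact: itv_convex.
have M0 := reg_itv_neq0 hM.
have cM : M @ u --> M u by exact: cvg_affine.
have cS : S @ u --> S u by exact: cvg_affine.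
have t0 : 0 < coord_t k (M u) (S u).
  have s0 : 0 < S u by move: hS; rewrite /reg_height; case: ifP; rewrite in_itv /=; lra.
  by rewrite ltr_wpDr ?reg_lo_ge0 // mulr_gt0 // reg_gap_gt0.
have cY : Y @ u --> Y u.
  apply: cvgM; first exact: cvg_cst.
  apply: cvgV; first by rewrite lt0r_neq0 // !sqrtr_gt0.
  apply: continuous_cvg; first exact: sqrt_continuous.
  apply: continuous_cvg; first exact: sqrt_continuous.
  apply: cvgD; first by apply: cvgM => //; exact: cvg_reg_gap.
  exact: cvg_reg_lo.
split; first exact: coord_region.
  by apply: cvgM => //; apply: cvgB => //; exact: cvg_cst.
exact: cvgM.
Qed.

Definition sheet k (s : bool) : set (ext R) :=
  [set p | exists r lam, region_set k (r, lam) /\ p = xi_ext (region_family k) s r lam].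

Lemma sheet_path k s (p q : ext R) : sheet k s p -> sheet k s q ->
  exists g : R -> ext R, [/\ {within `[0, 1], continuous g}, g 0 = p, g 1 = q &
    forall u, u \in `[0, 1] -> sheet k s (g u)].
Proof.
move=> [r [lam [hk ->]]] [r' [lam' [hk' ->]]].
have [f [g [[f0 g0] [f1 g1] h]]] := region_path hk hk'.
exists (fun u => xi_ext (region_family k) s (f u) (g u)); split.
- apply: continuous_in_subspaceT => u; rewrite inE => hu.
  have [hku cf cg] := h u hu.
  by apply: cvg_xi_ext => //; exact: delta_rho (region_delta hku).
- by rewrite f0 g0.
- by rewrite f1 g1.
- by move=> u hu; have [hku _ _] := h u hu; exists (f u), (g u).
Qed.

Lemma path_component (A : set (ext R)) (g : R -> ext R) :
  {within `[0, 1], continuous g} -> (forall u, u \in `[0, 1] -> A (g u)) ->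
  connected_component A (g 0) (g 1).
Proof.
move=> cg gA; exists (g @` `[0, 1]); last by exists 1; rewrite //= in_itv /= ler01 lexx.
split; first by exists 0; rewrite //= in_itv /= ler01 lexx.
  by move=> _ [u hu <-]; exact: gA.
exact/connected_continuous_connected/cg/segment_connected.
Qed.

Lemma sheet_component k s (A : set (ext R)) (p q : ext R) : sheet k s `<=` A ->
  sheet k s p -> sheet k s q -> connected_component A p q.
Proof.
move=> sA hp hq; have [g [cg <- <- h]] := sheet_path hp hq.
by apply: path_component cg _ => u /h /sA.
Qed.

End RegionPaths.

(** * Classes and connected components *)

Section Classes.
Variable R : realType.
Implicit Types (i : equil_family) (k : region) (c : curve) (r lam : R) (p q : ext R).

Lemma segment_sgr (h : R -> R) : {within `[0, 1], continuous h} ->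
  (forall u, u \in `[0, 1] -> h u != 0) ->
  forall u, u \in `[0, 1] -> Num.sg (h u) = Num.sg (h 0).
Proof.
move=> ch h0 u hu; have /andP[u0 u1] : 0 <= u <= 1 by rewrite in_itv in hu.
have z01 : 0 \in `[0, 1 : R] by rewrite in_itv /= lexx ler01.
have ch' : {within `[0, u], continuous h}.
  apply: continuous_subspaceW ch => v /=; rewrite !in_itv /= => /andP[-> /le_trans];
    exact.
have nz : ~ (Num.min (h 0) (h u) <= 0 <= Num.max (h 0) (h u)).
  move=> /(IVT u0 ch')[v]; rewrite in_itv /= => /andP[v0 vu] hv.
  suff /h0 : v \in `[0, 1] by rewrite hv eqxx.
  by rewrite in_itv /= v0 (le_trans vu).
have := h0 _ hu; have := h0 _ z01; rewrite !neq_lt => /orP[] a /orP[] b.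
- by rewrite !ltr0_sg.
- by case: nz; rewrite ge_min le_max (ltW a) (ltW b) orbT.
- by case: nz; rewrite ge_min le_max (ltW a) (ltW b) orbT.
- by rewrite !gtr0_sg.
Qed.

Lemma continuous_om1 : continuous (fun p : ext R => om1 p.1).
Proof.
move=> p; apply: (@continuous_comp _ _ _ fst (@om1 R)); first exact: cvg_fst.
exact: (differentiable_continuous (differentiable_coord6 (@Ordinal 6 0 isT) p.1)).
Qed.

Lemma continuous_om3 : continuous (fun p : ext R => om3 p.1).
Proof.
move=> p; apply: (@continuous_comp _ _ _ fst (@om3 R)); first exact: cvg_fst.
exact: (differentiable_continuous (differentiable_coord6 (@Ordinal 6 2 isT) p.1)).
Qed.

Lemma continuous_al1 : continuous (fun p : ext R => al1 p.1).
Proof.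
move=> p; apply: (@continuous_comp _ _ _ fst (@al1 R)); first exact: cvg_fst.
exact: (differentiable_continuous (differentiable_coord6 (@Ordinal 6 3 isT) p.1)).
Qed.

Lemma continuous_lam : continuous (fun p : ext R => p.2).
Proof. by move=> p; exact: cvg_snd. Qed.

Lemma continuous_rho : continuous (fun p : ext R => om3 p.1 - p.2).
Proof. by move=> p; apply: cvgB; [exact: continuous_om3|exact: continuous_lam]. Qed.

Lemma continuous_curve_fun c : continuous (fun p : ext R => curve_fun c (om3 p.1) p.2).
Proof.
move=> p.
have h3 : (fun q => om3 q.1) @ p --> om3 p.1 by exact: continuous_om3.
have hl : (fun q => q.2) @ p --> p.2 by exact: continuous_lam.
have hy : (fun q => q.2 - om3 q.1) @ p --> p.2 - om3 p.1 by exact: cvgB.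
have hr : (fun q => om3 q.1 - q.2) @ p --> om3 p.1 - p.2 by exact: cvgB.
have hy3 : (fun q => (q.2 - om3 q.1) ^+ 3) @ p --> (p.2 - om3 p.1) ^+ 3.
  by rewrite 2!exprS; apply: cvgM => //; apply: cvgM.
have h23 : (fun q => curve_fun Pi23 (om3 q.1) q.2) @ p --> curve_fun Pi23 (om3 p.1) p.2.
  apply: cvgB; last exact: cvg_cst.
  apply: cvgM => //; apply: cvgB => //.
  by apply: cvgM => //; exact: cvg_cst.
case: c => //.
- by apply: cvgB; [apply: cvgM|exact: cvg_cst].
- exact: cvgD.
- have hp : (fun q => om3 q.1 * (om3 q.1 - q.2)) @ p --> om3 p.1 * (om3 p.1 - p.2).
    exact: cvgM.
  apply: cvgB.
    by rewrite 2!exprS; apply: cvgM => //; apply: cvgM.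
  exact: cvgM.
Qed.

Lemma path_sgr (g : R -> ext R) (F : ext R -> R) :
  {within `[0, 1], continuous g} -> continuous F ->
  (forall u, u \in `[0, 1] -> F (g u) != 0) ->
  forall u, u \in `[0, 1] -> Num.sg (F (g u)) = Num.sg (F (g 0)).
Proof.
move=> cg cF h; apply: (segment_sgr _ h) => u.
exact: (cvg_comp _ _ (cg u) (cF (g u))).
Qed.

(** The parameters r and lam are coordinates of p itself, so the sign conditions become conditions
    on continuous functions of p that involve neither family nor sheet. *)
Lemma over_regionP k p : over_region k p ->
  exists s, [/\ region_set k (om3 p.1, p.2),
    p = xi_ext (region_family k) s (om3 p.1) p.2 &
    family_sign (region_family k) (al1 p.1) (om3 p.1 - p.2)].
Proof.
move=> [s [r [lam [hk ->]]]]; exists s => /=.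
have e : om3 (xi (region_family k) s r lam) = r by rewrite !mkphaseE.
by rewrite [X in family_sign _ _ (X - _)]e e; split=> //;
   rewrite -[X in family_sign _ _ (X - _)]e; exact: xi_family_sign (region_delta hk).
Qed.

Lemma family_sign_sgr i (a b a' b' : R) : Num.sg a = Num.sg a' -> Num.sg b = Num.sg
  b' ->
  family_sign i a b -> family_sign i a' b'.
Proof.
move=> ea eb.
have [a1 a2] : (0 < a) = (0 < a') /\ (a < 0) = (a' < 0).
  by rewrite -sgr_gt0 ea sgr_gt0 -[a < 0]sgr_lt0 ea sgr_lt0.
have [b1 b2] : (0 < b) = (0 < b') /\ (b < 0) = (b' < 0).
  by rewrite -sgr_gt0 eb sgr_gt0 -[b < 0]sgr_lt0 eb sgr_lt0.
by case: i; rewrite /= ?a1 ?a2 ?b1 ?b2.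
Qed.

(** The signs of alpha_1 and omega_3 - lam, nonzero along the path, fix the family. Only then are
    the curve functions of that family known not to vanish, and their signs fix the region. *)
Lemma path_region k (g : R -> ext R) : {within `[0, 1], continuous g} ->
  (forall u, u \in `[0, 1] -> nondeg_equilibria (g u)) ->
  over_region k (g 0) -> over_region k (g 1).
Proof.
move=> cg hg hk.
have z01 : 0 \in `[0, 1 : R] by rewrite in_itv /= lexx ler01.
have o01 : 1 \in `[0, 1 : R] by rewrite in_itv /= lexx ler01.
have al0 u : u \in `[0, 1] -> al1 (g u).1 != 0.
  move=> /hg /nondegenerate_over[k' /over_regionP[s [_ _]]].
  by case: region_family => /=; lra.
have rho0 u : u \in `[0, 1] -> om3 (g u).1 - (g u).2 != 0.
  by move=> /hg /nondegenerate_over[k' /over_regionP[s [/region_delta/delta_rho]]].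
have sa := path_sgr cg continuous_al1 al0.
have sr := path_sgr cg continuous_rho rho0.
have [s [hk0 _ f0]] := over_regionP hk.
have fam u k' : u \in `[0, 1] -> over_region k' (g u) -> region_family k' =
  region_family k.
  move=> hu /over_regionP[s' [_ _ /(family_sign_sgr (sa u hu) (sr u hu)) h]].
  exact: family_sign_inj h f0.
have [k1 hk1] := nondegenerate_over (hg 1 o01).
suff <- : k1 = k by [].
have [s1 [hk1' _ _]] := over_regionP hk1.
apply: sign_pos_inj; first exact: fam o01 hk1.
move=> c; rewrite (fam _ _ o01 hk1) => ec.
have c0 u : u \in `[0, 1] -> curve_fun c (om3 (g u).1) (g u).2 != 0.
  move=> hu; have [k' hk'] := nondegenerate_over (hg u hu).
  have [s' [/region_setE[_ h] _ _]] := over_regionP hk'.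
  rewrite (fam _ _ hu hk') in h; have := h c ec.
  by case: sign_pos => e; [exact: lt0r_neq0|exact: ltr0_neq0].
have sc := path_sgr cg (@continuous_curve_fun c) c0 o01.
have /region_setE[_ /(_ c ec)] := hk0.
have /region_setE[_ /(_ c)] := hk1'; rewrite (fam _ _ o01 hk1) => /(_ ec).
case: sign_pos; case: sign_pos => //;
  rewrite /has_bsign -sgr_gt0 -sgr_lt0 sc ?sgr_gt0 ?sgr_lt0; lra.
Qed.

Lemma tau_xi_ext i s r lam : tau (xi_ext i s r lam) = xi_ext i (~~ s) r lam.
Proof.
rewrite /tau /xi_ext /= /xi !mkphaseE; congr (mkphase _ _ _ _ _ _, _);
  by case: s => /=; rewrite ?expr0 ?expr1; ring.
Qed.

Lemma tau_region k p : over_region k p -> over_region k (tau p).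
Proof. by move=> [s [r [lam [hk ->]]]]; rewrite tau_xi_ext; exists (~~ s), r, lam. Qed.

Lemma tauK k p : over_region k (tau p) -> over_region k p.
Proof.
move=> h; have <- : tau (tau p) = p; last exact: tau_region.
by case: (p) => x lam; rewrite /tau /= !mkphaseE !opprK -mkphase_eta.
Qed.

Lemma sheet_over k s : @sheet R k s `<=` over_region k.
Proof. by move=> p [r [lam [hk ->]]]; exists s, r, lam. Qed.

Lemma sheet_joined k s p q : sheet k s p -> sheet k s q -> joined p q.
Proof.
move=> hp hq; have [g [cg g0 g1 h]] := sheet_path hp hq.
exists g; split=> //; exists (region_type k) => u /h hu.
split; first exact: over_region_nondegenerate (sheet_over hu).
by have [r [lam [hk ->]]] := hu; exact: xi_has_type.
Qed.

Lemma joined_region k p q : joined p q -> over_region k p -> over_region k q.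
Proof.
move=> [g [cg <- <- [t h]]]; apply: path_region => // u hu.
by have [] := h u hu.
Qed.

(** Since [tau] swaps the sheets and each sheet is path connected, two points over a region are
    joined directly or after [tau], even if the sheets are disjoint. *)
Lemma same_classE k p : over_region k p -> [set q | same_class p q] = over_region k.
Proof.
move=> hp; apply/seteqP; split=> q /=.
  move=> [_ _ [/joined_region|/joined_region]]; first exact.
  by move=> /(_ _ hp)/tauK.
move=> hq; split; [exact: over_region_nondegenerate hp
  |exact: over_region_nondegenerate hq|].
have [s [r [lam [hk ->]]]] := hp; have [s' [r' [lam' [hk' ->]]]] := hq.
have [<-|/eqP ss] := eqVneq s s'.
  by left; apply: (@sheet_joined k s); [exists r, lam|exists r', lam'].
right; rewrite tau_xi_ext (_ : ~~ s' = s); last by case: (s) (s') ss => -[].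
by apply: (@sheet_joined k s); [exists r, lam|exists r', lam'].
Qed.

Lemma over_region_nonempty k : exists p, @over_region R k p.
Proof.
have [r [lam hk]] := region_nonempty R k.
by exists (xi_ext (region_family k) false r lam), false, r, lam.
Qed.

Lemma equilibrium_classesE :
  @equilibrium_classes R = [set @over_region R k | k in [set: region]].
Proof.
apply/seteqP; split=> X [].
  by move=> p /nondegenerate_over[k hk] <-; exists k => //; rewrite (same_classE hk).
move=> k _ <-; have [p hp] := over_region_nonempty k.
by exists p; [exact: over_region_nondegenerate hp|exact: same_classE].
Qed.

Lemma over_region_inj : injective (@over_region R).
Proof.
move=> k k' e; have [p hp] := over_region_nonempty k.
by apply: (over_region_uniq hp); rewrite -e.
Qed.

Definition region_index k : nat :=
  match k with D1 => 0 | D21 => 1 | D22 => 2 | D23 => 3 | D24 => 4 | D25 => 5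
  | D26 => 6 | D27 => 7 | D28 => 8 | D31 => 9 | D32 => 10 end.

Lemma card_regions : ([set: region] #= `I_11)%card.
Proof.
have -> : `I_11 = region_index @` [set: region].
  apply/seteqP; split=> n /=; last by case=> -[] _ <-.
  do 11?[case: n => [|n]] => // _; by [exists D1|exists D21|exists D22|exists D23
    |exists D24|exists D25|exists D26|exists D27|exists D28|exists D31|exists D32].
by apply/card_esym/inj_card_eq => -[] [].
Qed.

Lemma card_bools : ([set: bool] #= `I_2)%card.
Proof.
have -> : `I_2 = nat_of_bool @` [set: bool].
  apply/seteqP; split=> n /=; last by case=> -[] _ <-.
  by do 2?[case: n => [|n]] => // _; [exists false|exists true].
by apply/card_esym/inj_card_eq => -[] [].
Qed.

Lemma card_classes : (@equilibrium_classes R #= `I_11)%card.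
Proof.
rewrite equilibrium_classesE; apply: card_eq_trans card_regions.
by apply: inj_card_eq => k k' _ _; exact: over_region_inj.
Qed.

(** The line r = 0 is m = 1, which lies in the m-interval of each of these regions. *)
Lemma region_zero k : region_connected k -> exists lam, region_set k (0 : R, lam).
Proof.
move=> ck; have hm : 1 \in reg_itv R k.
  by case: k ck => //= _; rewrite in_itv /=; rewrite ?andbT; do ?[apply/andP; split];
    lra.
have hs : 2^-1 \in reg_height R k.
  by rewrite /reg_height; case: reg_bounded; rewrite in_itv /= ?andbT; lra.
have := coord_region hm hs; rewrite subrr mul0r => h.
by eexists; exact: h.
Qed.

(** At r = 0 the [Pi22] function is lam > 0 and the [Pi24] function is - lam^2 < 0. Each region of
    the second family considered here requires the opposite sign of one of them, directly or through
    the order of the curves. *)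
Lemma region_neq0 k r lam : ~~ region_connected k -> region_set k (r, lam) -> r != 0.
Proof.
move=> nk /region_setE[hd h]; apply/eqP => r0; subst r.
have l0 := delta_lam hd.
case: k nk hd h => //= _ [h1 h2] h; try lra.
- by have := h Pi22 erefl; rewrite /has_bsign /=; lra.
- by have := (curve_fun_order (conj h1 h2 : delta_reg F2 (0, lam))).2;
  case=> /(_ (h Pi23 erefl) (h Pi24 erefl)) + _ _ _; rewrite /=; lra.
- by have := (curve_fun_order (conj h1 h2 : delta_reg F2 (0, lam))).2;
  case=> _ /(_ (h Pi23 erefl) (h Pi21 erefl)) + _ _; rewrite /=; lra.
- by have := h Pi22 erefl; rewrite /has_bsign /=; lra.
- by have := h Pi24 erefl;
  rewrite /has_bsign /= mul0r expr0n sub0r oppr_gt0 ltNge sqr_ge0.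
Qed.

Lemma om1_xi_sgr i s r lam : delta_reg i (r, lam) -> r != 0 ->
  Num.sg (om1 (xi i s r lam)) = (-1) ^+ s.
Proof.
move=> hd r0; rewrite /xi mkphaseE sgrM (gtr0_sg (V_of_gt0 hd r0)) mulr1.
by rewrite sgrX sgrN1.
Qed.

Lemma sheet_component_eq k s p : ~~ region_connected k -> @sheet R k s p ->
  connected_component (over_region k) p = sheet k s.
Proof.
move=> nk hp; apply/seteqP; split=> q; last first.
  by apply: sheet_component => //; exact: sheet_over.
have sg1 s' (x : ext R) : sheet k s' x -> Num.sg (om1 x.1) = (-1) ^+ s'.
  move=> [r [lam [hk ->]]].
  exact: (om1_xi_sgr s' (region_delta hk) (region_neq0 nk hk)).
case=> C [Cp CA cC] Cq.
have [s' [r [lam [hk hq]]]] := CA _ Cq.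
have hq' : sheet k s' q by exists r, lam.
have [<- //|ss] := eqVneq s' s.
have itv : is_interval ((fun x : ext R => om1 x.1) @` C).
  apply/connected_intervalP/connected_continuous_connected => //.
  by apply: continuous_subspaceT => x; exact: continuous_om1.
have e1 := sg1 _ _ hp; have e2 := sg1 _ _ hq'.
(* A connected set meeting both sheets would contain a point with omega_1 = 0, but omega_1 has sign
   1 or -1 on each sheet. *)
have [x Cx x0] : ((fun x : ext R => om1 x.1) @` C) 0.
  case: s e1 ss {hp} => /= e1; case: s' e2 {hq'} hq => //= e2 _ _.
    apply: (itv (om1 p.1) (om1 q.1)); [by exists p|by exists q|].
    by rewrite -sgr_le0 e1 -sgr_ge0 e2 expr0 expr1 lerN10 ler01.
  apply: (itv (om1 q.1) (om1 p.1)); [by exists q|by exists p|].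
  by rewrite -sgr_le0 e2 -sgr_ge0 e1 expr0 expr1 lerN10 ler01.
have [s1 [r1 [lam1 [hk1 hx]]]] := CA _ Cx.
have /sg1 : sheet k s1 x by exists r1, lam1.
by rewrite x0 sgr0 => /esym/eqP; rewrite signr_eq0.
Qed.

Lemma sheet_nonempty k s : exists p, @sheet R k s p.
Proof.
have [r [lam hk]] := region_nonempty R k.
by exists (xi_ext (region_family k) s r lam), r, lam.
Qed.

Lemma card_components k : ~~ region_connected k ->
  (conn_components (@over_region R k) #= `I_2)%card.
Proof.
move=> nk; have -> : conn_components (@over_region R k) = @sheet R k @` [set: bool].
  apply/seteqP; split=> X [].
    move=> p hp <-; have [s [r [lam [hk e]]]] := hp.
    by exists s => //; rewrite (@sheet_component_eq k s) //; exists r, lam.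
  move=> s _ <-; have [p hp] := sheet_nonempty k s.
  by exists p; [exact: sheet_over hp|exact: sheet_component_eq].
apply: card_eq_trans card_bools; apply: inj_card_eq => s s' _ _ e.
have [p [r [lam [hk hp]]]] := sheet_nonempty k s.
have [r' [lam' [hk' hp']]] : sheet k s' p by rewrite -e; exists r, lam.
have := om1_xi_sgr s (region_delta hk) (region_neq0 nk hk).
have := om1_xi_sgr s' (region_delta hk') (region_neq0 nk hk').
have -> : xi (region_family k) s' r' lam' = xi (region_family k) s r lam.
  by move: hp'; rewrite hp => -[].
move=> -> {e hp hp' hk hk'}; case: s s' => -[] //=; rewrite ?expr0 ?expr1 => h;
  exfalso; lra.
Qed.

Lemma over_region_connected k : region_connected k -> connected (@over_region R k).
Proof.
move=> ck; have [lam h0] := region_zero ck.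
pose p0 := xi_ext (region_family k) false 0 lam.
(* V vanishes at r = 0, so [p0] is common to both sheets, and every point is connected to it. *)
have hp0 s : sheet k s p0.
  exists 0, lam; split=> //; rewrite /p0 /xi_ext /xi.
  have -> : V_of (region_family k) 0 lam = 0 by rewrite /V_of !mul0r sqrtr0.
  by rewrite !mulr0.
have -> : over_region k = connected_component (over_region k) p0.
  apply/seteqP; split=> q; last exact: connected_component_sub.
  move=> [s [r [lam' [hk hq]]]].
  by apply: (sheet_component (@sheet_over k s) (hp0 s)); exists r, lam'.
exact: component_connected.
Qed.

End Classes.

Theorem theorem1 (R : realType) :
  (* the families exhaust the relative equilibria, the curves lie in the
     corresponding regions *)
  (forall lam : R, 0 < lam ->
     rel_equilibria lam = Rfam F1 lam `|` Rfam F2 lam `|` Rfam F3 lam) /\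
  (forall c : curve, @curve_set R c `<=` @delta_reg R (curve_family c)) /\
  (* (1) *)
  (forall (i : equil_family) (s : bool) (r lam : R), delta_reg i (r, lam) ->
     (is_degenerate (xi_ext i s r lam) <->
        exists c : curve, curve_family c = i /\ curve_set c (r, lam)) /\
     (is_strongly_degenerate (xi_ext i s r lam) <->
        i = F2 /\ curve_set Pi21 (r, lam))) /\
  (forall (s : bool) (r lam : R), delta_reg F1 (r, lam) ->
     ~ is_degenerate (xi_ext F1 s r lam)) /\
  (* (2) *)
  (@equilibrium_classes R = [set @over_region R k | k in [set: region]] /\
   (@equilibrium_classes R #= `I_11)%card /\
   (forall k : region,
      if region_connected k then connected (@over_region R k)
      else (conn_components (@over_region R k) #= `I_2)%card)) /\
  (* (3) *)
  (forall (i : equil_family) (s : bool) (r lam : R), delta_reg i (r, lam) ->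
     exists m1 m2 : complex R,
       [/\ eigenvalue_pairs (xi_ext i s r lam) m1 m2,
           m1 ^+ 2 = real_complex R (mu1sq i r lam) &
           m2 ^+ 2 = real_complex R (mu2sq i r lam)]) /\
  (forall (k : region) (s : bool) (r lam : R), region_set k (r, lam) ->
     let i := region_family k in
     [/\ has_sign (region_type k).1 (mu1sq i r lam),
         has_sign (region_type k).2 (mu2sq i r lam),
         has_type (xi_ext i s r lam) (region_type k) &
         has_stability (xi_ext i s r lam) (region_stability k)]).
Proof.
split; first by move=> lam; exact: rel_equilibriaE.
split; first by move=> c [r lam] /curve_setE[].
have degE (i : equil_family) (s : bool) (r lam : R) : delta_reg i (r, lam) ->
    is_degenerate (xi_ext i s r lam) <->
    exists c : curve, curve_family c = i /\ curve_set c (r, lam).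
  move=> hd; rewrite /is_degenerate (xi_nondegenerate_curves s hd); split.
    move=> /existsNP[c /not_implyP[e /negP/negPn/eqP c0]].
    by exists c; split=> //; apply/curve_setE; rewrite e.
  by move=> [c [e /curve_setE[_ c0]]] /(_ c e); rewrite c0 eqxx.
split.
  move=> i s r lam hd; split; first exact: degE.
  rewrite /is_strongly_degenerate (xi_cond_indep_curve s hd); split.
    by move=> [_ [e c0]]; split=> //; apply/curve_setE; split=> //; move: hd; rewrite e.
  move=> [e h]; split; last by split=> //; have /curve_setE[] := h.
  by apply/degE => //; exists Pi21.
split; first by move=> s r lam hd /(degE _ _ _ _ hd)[[] []].
split.
  split; first exact: equilibrium_classesE.
  split; first exact: card_classes.
  move=> k; case: ifPn; first exact: over_region_connected.
  exact: card_components.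
split; first by move=> i s r lam hd; exact: xi_eigenvalues.
move=> k s r lam hk i; have [h1 h2] := region_signs hk.
have ht := xi_has_type s hk; split=> //.
by exists (region_type k); split=> //; case: (k).
Qed.
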